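(* Let $X$ be a subordinator with drift $\mathrm{d}\ge0$ and infinite Lévy measure $\Pi$. Then for every $t>0$, almost surely, $$\lim_{\delta\to0}\frac{L(t,\delta)}{\mu(\delta)}=t,$$ where $\mu(\delta):=\frac1\delta\big(\mathrm{d}+I(\delta)\big)$ and $I(\delta):=\int_0^\delta\overline{\Pi}(y)\,dy$, with $\overline{\Pi}(y):=\Pi((y,\infty))$.
   Context: A subordinator is a non-decreasing real-valued Lévy process started at $0$ (càdlàg paths, stationary independent increments). Its law is determined by $\mathbb{E}[e^{-\lambda X_1}]=e^{-\Phi(\lambda)}$, $\lambda\ge0$, with $\Phi(\lambda)=\mathrm{d}\lambda+\int_0^\infty(1-e^{-\lambda x})\,\Pi(dx)$, where $\mathrm{d}\ge 0$ is the drift and $\Pi$ is the Lévy measure on $(0,\infty)$, satisfying $\int_0^\infty(1\wedge x)\,\Pi(dx)<\infty$. ''Infinite Lévy measure'' means $\Pi((0,\infty))=\infty$. One has $X_t=\mathrm{d}t+\sum_{0<s\le t}\Delta X_s$ with $\Delta X_s:=X_s-X_{s-}$. For $\delta>0$, the process of $\delta$-shortened jumps $\tilde X^\delta=(\tilde X^\delta_t)_{t\ge0}$ is obtained from $X$ by shortening every jump of size larger than $\delta$ to have size exactly $\delta$, i.e. $\tilde X^\delta_t=\mathrm{d}t+\sum_{0<s\le t}(\Delta X_s\wedge\delta)$. Define $L(t,\delta):=\frac1\delta\tilde X^\delta_t$ (all these processes, for different $\delta$, are built from the same path of $X$). *)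

(* Defs.v *)
From HB Require Import structures.
From mathcomp Require Import all_boot all_order all_algebra.
From mathcomp Require Import all_classical all_reals all_analysis.

Set Implicit Arguments.
Unset Strict Implicit.
Unset Printing Implicit Defensive.

Import Order.TTheory GRing.Theory Num.Theory.
Import numFieldNormedType.Exports.

Local Open Scope classical_set_scope.
Local Open Scope ring_scope.

(* Time is indexed by R; only times 0 <= t are ever constrained or used. *)

Definition cadlag (R : realType) (x : R -> R) : Prop :=
  (forall t, 0 <= t -> x s @[s --> t^'+] --> x t) /\
  (forall t, 0 < t -> cvg (x s @[s --> t^'-])).

Definition left_limit (R : realType) (x : R -> R) (s : R) : R :=
  lim (x u @[u --> s^'-]).

Definition jump (R : realType) (x : R -> R) (s : R) : R :=
  x s - left_limit x s.

Definition subordinator_path (R : realType) (x : R -> R) : Prop :=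
  [/\ x 0 = 0,
      (forall s t, 0 <= s -> s <= t -> x s <= x t) &
      cadlag x].

(* Taking some of the B i equal to setT shows that the product rule below
   covers every subfamily of the increments. *)
Definition independent_increments (R : realType) (d : measure_display)
    (T : measurableType d) (P : probability T R) (X : R -> {RV P >-> R}) : Prop :=
  forall (n : nat) (t : nat -> R) (B : nat -> set R),
    0 <= t 0%N -> (forall i, (i < n)%N -> t i <= t i.+1) ->
    (forall i, (i < n)%N -> measurable (B i)) ->
    P [set w | forall i, (i < n)%N -> B i (X (t i.+1) w - X (t i) w)] =
    (\prod_(i < n) P [set w | B i (X (t i.+1) w - X (t i) w)%R])%E.

Definition stationary_increments (R : realType) (d : measure_display)
    (T : measurableType d) (P : probability T R) (X : R -> {RV P >-> R}) : Prop :=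
  forall (s h : R) (B : set R), 0 <= s -> 0 <= h -> measurable B ->
    P [set w | B (X (s + h) w - X s w)] = P [set w | B (X h w - X 0 w)].

Record subordinator (R : realType) (d : measure_display)
    (T : measurableType d) (P : probability T R) (X : R -> {RV P >-> R}) : Prop :=
  Subordinator {
    subordinator_paths :
      {ae P, forall w, subordinator_path (fun s => X s w)} ;
    subordinator_independent : independent_increments X ;
    subordinator_stationary : stationary_increments X }.

(* A measure on (0, +oo) is a Borel measure on R that does not charge
   ]-oo, 0]. *)
Definition levy_measure (R : realType) (Pi : {measure set R -> \bar R}) : Prop :=
  Pi `]-oo, 0]%classic = 0%E /\
  (\int[Pi]_(x in `]0%R, +oo[) (Num.min 1%R x)%:E < +oo)%E.

Definition laplace_exponent (R : realType) (drift : R)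
    (Pi : {measure set R -> \bar R}) (lambda : R) : \bar R :=
  ((drift * lambda)%:E +
   \int[Pi]_(x in `]0%R, +oo[) (1 - expR (- (lambda * x)))%:E)%E.

Definition has_characteristics (R : realType) (d : measure_display)
    (T : measurableType d) (P : probability T R) (X : R -> {RV P >-> R})
    (drift : R) (Pi : {measure set R -> \bar R}) : Prop :=
  [/\ 0 <= drift, levy_measure Pi &
      forall lambda : R, 0 <= lambda ->
        ('E_P[fun w => expR (- (lambda * X 1 w))%R] =
         expeR (- laplace_exponent drift Pi lambda))%E].

(* The sum over the uncountable set of times ]0, t] is the unconditional sum
   of nonnegative terms, valued in \bar R. *)
Definition shortened (R : realType) (drift : R) (x : R -> R) (delta t : R) :
    \bar R :=
  ((drift * t)%:E +
   (\esum_(s in `]0%R, t]) (Num.min (jump x s) delta)%:E)%R)%E.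

Definition L (R : realType) (drift : R) (x : R -> R) (t delta : R) : \bar R :=
  ((delta^-1)%:E * shortened drift x delta t)%E.

Definition Pi_tail (R : realType) (Pi : {measure set R -> \bar R}) (y : R) :
    \bar R := Pi `]y, +oo[%classic.

Definition tail_integral (R : realType) (Pi : {measure set R -> \bar R}) (delta : R) :
    \bar R :=
  (\int[lebesgue_measure]_(y in `[0%R, delta]) Pi_tail Pi y)%E.

Definition mu (R : realType) (drift : R) (Pi : {measure set R -> \bar R})
    (delta : R) : \bar R :=
  ((delta^-1)%:E * (drift%:E + tail_integral Pi delta))%E.

(* Main.v *)
(* Cut ]0, t] into n equal cells and let S_n be the sum of the increments of X
   over the cells, each truncated at delta.

   Pathwise, S_n tends to c + J(delta), where J(delta) is the sum of the jumps
   shortened to delta and c does not depend on delta: min(x, delta) is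
   x - (x - delta)^+, the map (x - delta)^+ is superadditive, and on a fine
   grid each increment exceeds some jump of its cell by at most eta.

   In probability, the Laplace transform of X_h is exp(-h Phi), so that
   n E[(1 - Y_n) Y_n^k] converges for Y_n = exp(-X_(t/n)); polynomial
   approximation turns this into E S_n -> m(delta) := t (d + I(delta)).
   As the increments are independent and min(x, delta)^2 <= delta min(x, delta),
   the variance of S_n is at most delta E S_n.

   By Fatou, E (c + J(delta) - m(delta))^2 <= delta m(delta). Choosing delta_k
   with mu(delta_k) = (k + K)(k + K + 1) makes delta_k / m(delta_k) summable,
   hence (c + J(delta_k)) / m(delta_k) -> 1 almost surely. Letting k go to
   infinity gives c = d t, and since L(t, .) and mu are nonincreasing while
   mu(delta_(k+1)) / mu(delta_k) -> 1, the limit extends to all delta. *)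
Require Import Defs.
From HB Require Import structures.
From mathcomp Require Import all_boot all_order all_algebra.
From mathcomp Require Import all_classical all_reals all_analysis.
From mathcomp Require Import measurable_realfun.
From mathcomp Require Import ring lra.

Set Implicit Arguments.
Unset Strict Implicit.
Unset Printing Implicit Defensive.

Import Order.TTheory GRing.Theory Num.Theory.
Import numFieldNormedType.Exports.

Local Open Scope classical_set_scope.
Local Open Scope ring_scope.

(** * Paths of subordinators *)

(** The characteristics enter only through the law of X_1, the jumps only through the path, and no
    Poisson structure of the jumps is given. The sums S_n connect the two sides: they depend on
    finitely many increments, so their moments follow from the law, and each path determines their
    limit. The price is the constant c, which becomes known only at the end.

    The quadratic growth of mu(delta_k) is a compromise. The mean square of (c + J(delta_k)) /
    m(delta_k) - 1 is at most 1 / (t mu(delta_k)), which has to be summable, while the passage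
    between consecutive delta_k requires mu(delta_(k+1)) / mu(delta_k) -> 1. Linear growth fails the
    first requirement, geometric growth the second; products of consecutive integers meet both, and
    their inverses telescope. *)

Definition grid (R : realType) (t : R) (n i : nat) : R := i%:R / n.+1%:R * t.

Lemma grid0 (R : realType) (t : R) n : grid t n 0 = 0.
Proof. by rewrite /grid !mul0r. Qed.

Lemma grid_last (R : realType) (t : R) n : grid t n n.+1 = t.
Proof. by rewrite /grid divff ?mul1r// pnatr_eq0. Qed.

Lemma grid_step (R : realType) (t : R) n i :
  grid t n i.+1 = grid t n i + t / n.+1%:R.
Proof. by rewrite /grid -natr1; ring. Qed.

Lemma grid_ge0 (R : realType) (t : R) n i : 0 <= t -> 0 <= grid t n i.
Proof. by move=> t0; rewrite /grid mulr_ge0// divr_ge0. Qed.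

Lemma le_grid (R : realType) (t : R) n i j :
  0 <= t -> (i <= j)%N -> grid t n i <= grid t n j.
Proof.
by move=> t0 ij; rewrite /grid ler_wpM2r// ler_wpM2r ?invr_ge0// ler_nat.
Qed.

Lemma lt_grid (R : realType) (t : R) n i j :
  0 < t -> (i < j)%N -> grid t n i < grid t n j.
Proof.
by move=> t0 ij; rewrite /grid ltr_pM2r// ltr_pM2r ?invr_gt0// ltr_nat.
Qed.

Lemma near_natSinv (R : realType) (a e : R) : 0 < e ->
  \forall n \near \oo, a / n.+1%:R < e.
Proof.
move=> e0; near=> n; rewrite ltr_pdivrMr// mulrC -ltr_pdivrMr//.
apply: (@lt_trans _ _ n%:R); last by rewrite ltr_nat.
near: n; exact: nbhs_infty_gtr.
Unshelve. all: by end_near. Qed.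

Section subordinator_path_theory.
Context (R : realType) (x : R -> R).
Hypothesis px : subordinator_path x.

Lemma path_le (a b : R) : 0 <= a -> a <= b -> x a <= x b.
Proof. by case: px => _ + _; apply. Qed.

Lemma path0 : x 0 = 0.
Proof. by case: px. Qed.

Lemma cvg_left_limit (s : R) : 0 < s -> x u @[u --> s^'-] --> left_limit x s.
Proof. by move=> s0; case: px => _ _ [_]; exact. Qed.

Lemma path_le_left_limit (a s : R) : 0 <= a -> a < s -> x a <= left_limit x s.
Proof.
move=> a0 as_; apply: limr_ge.
  exact: (cvgP _ (cvg_left_limit (le_lt_trans a0 as_))).
near=> u; apply: path_le => //; near: u.
by apply: filterS (nbhs_left_gt as_) => u /ltW.
Unshelve. all: by end_near. Qed.

Lemma left_limit_le (s : R) : 0 < s -> left_limit x s <= x s.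
Proof.
move=> s0; apply: limr_le; first exact: (cvgP _ (cvg_left_limit s0)).
near=> u; apply: path_le.
  by apply: ltW; near: u; exact: nbhs_left_gt.
by apply: ltW; near: u; exact: nbhs_left_lt.
Unshelve. all: by end_near. Qed.

Lemma jump_ge0 (s : R) : 0 < s -> 0 <= jump x s.
Proof. by move=> s0; rewrite subr_ge0 left_limit_le. Qed.

Lemma jump_le (a s b : R) : 0 <= a -> a < s -> s <= b -> jump x s <= x b - x a.
Proof.
move=> a0 as_ sb; rewrite /jump lerB ?path_le_left_limit//.
by apply: path_le => //; exact/ltW/(le_lt_trans a0).
Qed.

(** Around any time [u0] the path varies by less than [eta / 2] on either side, by right continuity
    and the left limit, so a cell close to [u0] gains at most the jump at [u0] plus [eta].
    Compactness of [[0, t]] makes the required fineness uniform. *)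
Lemma near_grid_jump (t eta : R) : 0 < t -> 0 < eta ->
  \forall n \near \oo, forall i, (i < n.+1)%N ->
    exists2 s, grid t n i < s <= grid t n i.+1 &
      x (grid t n i.+1) - x (grid t n i) <= jump x s + eta.
Proof.
move=> t0 eta0.
(* [Q n u] speaks of every cell that contains [u], which turns a claim about cells into one about
   points of a compact set. *)
pose Q (n : nat) u := forall i, (i < n.+1)%N ->
    grid t n i <= u <= grid t n i.+1 ->
    exists2 s, grid t n i < s <= grid t n i.+1 &
      x (grid t n i.+1) - x (grid t n i) <= jump x s + eta.
have /compact_near_coveringP cov := @segment_compact R 0 t.
have {cov} : \forall n \near \oo, `[0, t] `<=` Q n.
  apply: cov => u0; rewrite /= in_itv/= => /andP[u00 _].
  have [r1 r10 hr1] : exists2 r, 0 < r &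
      forall u, u0 <= u < u0 + r -> x u - x u0 < eta / 2.
    have : \forall u \near u0^'+, `|x u0 - x u| < eta / 2.
      case: px => _ _ [+ _] => /(_ _ u00)/cvgrPdist_lt; apply.
      by rewrite divr_gt0.
    case => r /= r0 hr; exists r => // u /andP[u0u uu0].
    move: u0u; rewrite le_eqVlt => /predU1P[<-|u0u].
      by rewrite subrr divr_gt0.
    have := hr u; rewrite /= distrC => /(_ _ u0u) h.
    rewrite (le_lt_trans (ler_norm _))// distrC h//.
    by rewrite ltr_norml; apply/andP; split; lra.
  have [r2 r20 hr2] : exists2 r, 0 < r &
      0 < u0 -> forall u, u0 - r < u < u0 -> left_limit x u0 - x u < eta / 2.
    move: u00; rewrite le_eqVlt => /predU1P[<-|u00]; first by exists 1; rewrite ?ltxx.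
    have : \forall u \near u0^'-, `|left_limit x u0 - x u| < eta / 2.
      have /cvgrPdist_lt := cvg_left_limit u00; apply.
      by rewrite divr_gt0.
    case => r /= r0 hr; exists r => // _ u /andP[u0u uu0].
    have := hr u; rewrite /= => /(_ _ uu0) h.
    rewrite (le_lt_trans (ler_norm _))// h//.
    by rewrite ltr_norml; apply/andP; split; lra.
  pose r := Num.min r1 r2.
  have r0 : 0 < r by rewrite lt_min r10.
  have rr1 : r <= r1 by rewrite ge_min lexx.
  have rr2 : r <= r2 by rewrite ge_min lexx orbT.
  move: (r) r0 rr1 rr2 => {}r r0 rr1 rr2.
  (* The point [u] is within [r / 2] of [u0] and the mesh is below [r / 2], so the whole cell of [u]
     lies within [r] of [u0]. *)
  near=> u n; move=> i /= iN /andP[iu ui].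
  have un : `|u0 - u| < r / 2.
    by near: u; apply: nbhsx_ballx; rewrite divr_gt0.
  have tn : t / n.+1%:R < r / 2.
    by near: n; apply: near_natSinv; rewrite divr_gt0.
  have ia : 0 <= grid t n i by apply: grid_ge0; exact: ltW.
  have iS : grid t n i < grid t n i.+1 by apply: lt_grid.
  have gi := grid_step t n i.
  move: (t / n.+1%:R) tn gi => h hr gi.
  have /andP[un1 un2] : (u0 - r / 2 < u) && (u < u0 + r / 2).
    by move: un; rewrite ltr_norml => /andP[*]; apply/andP; split; lra.
  (* The cell lies to the right of [u0], contains it, or lies to its left. In the outer cases the
     increment is below [eta / 2] and any jump of the cell will do, since jumps are nonnegative. *)
  have [iu0|u0i] := leP u0 (grid t n i).
    exists (grid t n i.+1); first by rewrite iS lexx.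
    have h1 : x (grid t n i.+1) - x u0 < eta / 2.
      by apply: hr1; apply/andP; split; lra.
    have h2 : x u0 <= x (grid t n i) by apply: path_le.
    have h3 : 0 <= jump x (grid t n i.+1) by apply: jump_ge0; lra.
    lra.
  have u0p : 0 < u0 by lra.
  have h2 : left_limit x u0 - x (grid t n i) < eta / 2.
    by apply: hr2 => //; apply/andP; split; lra.
  have [iu0|{}u0i] := leP u0 (grid t n i.+1).
    exists u0; first by rewrite u0i.
    have h1 : x (grid t n i.+1) - x u0 < eta / 2.
      by apply: hr1; apply/andP; split; lra.
    rewrite /jump; lra.
  exists (grid t n i.+1); first by rewrite iS lexx.
  have h1 : x (grid t n i.+1) <= left_limit x u0.
    by apply: path_le_left_limit => //; lra.
  have h3 : 0 <= jump x (grid t n i.+1) by apply: jump_ge0; lra.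
  lra.
apply: filterS => n hn i iN; apply: (hn (grid t n i)) => //.
  rewrite /= in_itv/=; apply/andP; split; first exact/grid_ge0/ltW.
  apply: (@le_trans _ _ (grid t n n.+1)); last by rewrite grid_last.
  by apply: le_grid; [exact: ltW|exact: ltnW].
by rewrite lexx/= ltW// lt_grid.
Unshelve. all: by end_near. Qed.

End subordinator_path_theory.

(** * Truncation at delta and the part cut off *)

Definition excess (R : realType) (delta a : R) : R := Num.max (a - delta) 0.

(** The outer maximum keeps the value in [[0, delta]] for every real [a]: increments are nonnegative
    only almost surely, while the integrals below range over all outcomes. *)
Definition trunc (R : realType) (delta a : R) : R := Num.max (Num.min a delta) 0.

Lemma excess_ge0 (R : realType) (delta a : R) : 0 <= excess delta a.
Proof. by rewrite /excess le_max lexx orbT. Qed.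

Lemma excess0 (R : realType) (a : R) : 0 <= a -> excess 0 a = a.
Proof. by move=> a0; rewrite /excess subr0 max_l. Qed.

(** A convex function that vanishes at 0 is superadditive on [[0, +oo[]. *)
Lemma excessD (R : realType) (delta a b : R) : 0 <= delta -> 0 <= a -> 0 <= b ->
  excess delta a + excess delta b <= excess delta (a + b).
Proof.
move=> d0 a0 b0; rewrite /excess.
by case: (leP (a - delta) 0) => ?; case: (leP (b - delta) 0) => ?;
  case: (leP (a + b - delta) 0) => ?; lra.
Qed.

Lemma le_excess (R : realType) (delta a b : R) : a <= b ->
  excess delta a <= excess delta b.
Proof.
move=> ab; rewrite /excess.
by case: (leP (a - delta) 0) => ?; case: (leP (b - delta) 0) => ?; lra.
Qed.

Lemma excessB_le (R : realType) (delta a : R) : 0 <= delta ->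
  a - delta <= excess delta a.
Proof. by move=> d0; rewrite /excess le_max lexx. Qed.

Lemma min_excess (R : realType) (delta a : R) :
  Num.min a delta + excess delta a = a.
Proof.
by rewrite /excess; case: (leP a delta) => ?; case: (leP (a - delta) 0) => ?; lra.
Qed.

Lemma trunc_excess (R : realType) (delta a : R) : 0 <= delta -> 0 <= a ->
  trunc delta a = a - excess delta a.
Proof.
move=> d0 a0; rewrite /trunc /excess.
case: (leP a delta) => ?; case: (leP (a - delta) 0) => ?;
  case: leP => ?; lra.
Qed.

(* If the increment exceeds [delta] then [1 <= b / delta]. *)
Lemma excess_perturb (R : realType) (delta eta a b : R) :
  0 < delta -> 0 <= eta -> 0 <= b -> b <= a + eta ->
  excess delta b <= excess delta a + eta * (b / delta).
Proof.
move=> d0 e0 b0 ba.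
have q0 : 0 <= eta * (b / delta) by rewrite mulr_ge0// divr_ge0// ltW.
have [bd|db] := leP b delta.
  by rewrite {1}/excess max_r ?subr_le0// addr_ge0 ?excess_ge0.
have : eta <= eta * (b / delta).
  by rewrite ler_peMr// ler_pdivlMr// mul1r ltW.
rewrite /excess.
by case: (leP (a - delta) 0) => ?; case: (leP (b - delta) 0) => ?; lra.
Qed.

(** * Sums over a grid and sums over the jumps *)

Section path_limit.
Context (R : realType) (x : R -> R).
Hypothesis px : subordinator_path x.

(** In a sorted list of times, each jump is bounded by the increment since the preceding time, and
    superadditivity merges these increments. *)
Lemma sum_excess_jump (delta a b : R) (l : seq R) : 0 <= delta -> 0 <= a ->
  a <= b -> path <%R a l -> all (<= b) l ->
  \sum_(s <- l) excess delta (jump x s) <= excess delta (x b - x a).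
Proof.
move=> d0; elim: l a => [|s l ih] a a0 ab /=.
  by rewrite big_nil excess_ge0.
move=> /andP[as_ pl] /andP[sb al]; rewrite big_cons.
have s0 : 0 <= s by exact/ltW/(le_lt_trans a0).
have /(lerD (le_excess delta (jump_le px a0 as_ (lexx s)))) := ih s s0 sb pl al.
move=> /le_trans; apply.
have -> : x b - x a = (x s - x a) + (x b - x s) by ring.
by apply: excessD => //; rewrite subr_ge0 path_le// ltW.
Qed.

Definition esum_excess (delta a b : R) : \bar R :=
  (\esum_(s in `]a, b]) (excess delta (jump x s))%:E)%R.

Lemma esum_excess_ge0 (delta a b : R) : (0 <= esum_excess delta a b)%E.
Proof. by apply: esum_ge0 => s _; rewrite lee_fin excess_ge0. Qed.

Lemma esum_excess_le (delta a b : R) : 0 <= delta -> 0 <= a -> a <= b ->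
  (esum_excess delta a b <= (excess delta (x b - x a))%:E)%E.
Proof.
move=> d0 a0 ab; apply: ge_ereal_sup => _ [F [finF FI] <-].
rewrite fsbig_finite//= sumEFin lee_fin.
pose l := finmap.enum_fset (fset_set F).
have lF s : s \in l -> a < s <= b.
  by rewrite [_ \in l](in_fset_set finF) inE => /FI; rewrite /= in_itv.
have pl : perm_eq l (sort <=%R l) by rewrite perm_sym perm_sort.
rewrite (perm_big _ pl)/=; apply: sum_excess_jump => //.
- rewrite path_min_sorted; first by rewrite sort_lt_sorted finmap.fset_uniq.
  by rewrite all_sort; apply/allP => s /lF/andP[].
- by rewrite all_sort; apply/allP => s /lF/andP[].
Qed.

Lemma esum_excess_fin (delta a b : R) : 0 <= delta -> 0 <= a -> a <= b ->
  esum_excess delta a b \is a fin_num.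
Proof.
move=> d0 a0 ab; rewrite ge0_fin_numE ?esum_excess_ge0//.
by rewrite (le_lt_trans (esum_excess_le d0 a0 ab))// ltry.
Qed.

Lemma esum_excess_split (delta a b c : R) : a <= b -> b <= c ->
  esum_excess delta a c = (esum_excess delta a b + esum_excess delta b c)%E.
Proof.
move=> ab bc; rewrite /esum_excess (esumID `]a, b]%classic); last first.
  by move=> s _; rewrite lee_fin excess_ge0.
have -> : `]a, c] `&` `]a, b] = `]a, b]%classic.
  apply/seteqP; split => s/=; rewrite !in_itv/=; first by case.
  by move=> /andP[as_ sb]; rewrite as_ sb (le_trans sb bc).
have -> // : `]a, c] `&` ~` `]a, b] = `]b, c]%classic.
apply/seteqP; split => s/=; rewrite !in_itv/=.
  by move=> [/andP[-> ->]] /negP; rewrite -ltNge andbT.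
move=> /andP[bs ->]; rewrite (le_lt_trans ab bs); split => //.
by apply/negP; rewrite -ltNge.
Qed.

Lemma esum_excess_grid (delta t : R) n k : 0 < t ->
  (esum_excess delta 0 (grid t n k) =
   \sum_(i < k) esum_excess delta (grid t n i) (grid t n i.+1))%E.
Proof.
move=> t0; elim: k => [|k ih].
  rewrite big_ord0 grid0 /esum_excess esum1// => s/=.
  by rewrite in_itv/= => /andP[/lt_le_trans/[apply]]; rewrite ltxx.
rewrite big_ord_recr/= -ih -esum_excess_split//.
  by apply: grid_ge0; exact: ltW.
by apply: le_grid => //; exact: ltW.
Qed.

Lemma jump_le_esum_excess (delta a s b : R) : a < s -> s <= b ->
  ((excess delta (jump x s))%:E <= esum_excess delta a b)%E.
Proof.
move=> as_ sb; apply: esum_ge; exists [set s]; last by rewrite fsbig_set1.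
by split; [exact: finite_set1|move=> _ ->; rewrite /= in_itv/= as_].
Qed.

(** In each cell, the excess of the increment dominates the sum over the jumps of the cell, and
    [near_grid_jump] bounds it above by the excess of a single jump plus a small error. *)
Lemma cvg_excess_grid (t delta : R) : 0 < t -> 0 < delta ->
  \sum_(i < n.+1) excess delta (x (grid t n i.+1) - x (grid t n i))
    @[n --> \oo] --> fine (esum_excess delta 0 t).
Proof.
move=> t0 d0.
have e0t := esum_excess_fin (ltW d0) (lexx 0) (ltW t0).
have xt0 : 0 <= x t by rewrite -(path0 px) path_le// ltW.
apply/cvgrPdist_le => e e0.
(* The error in a cell is [eta] times the increment over [delta]. These errors telescope to
   [eta * (x t / delta)], whatever the number of cells. *)
have [eta eta0 heta] : exists2 eta, 0 < eta & eta * (x t / delta) <= e.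
  exists (e / (x t / delta + 1)).
    by rewrite divr_gt0// ltr_pwDr// divr_ge0// ltW.
  rewrite mulrAC ler_pdivrMr ?ltr_pwDr ?divr_ge0 ?(ltW d0)//.
  by rewrite ler_wpM2l ?(ltW e0)// lerDl.
have := near_grid_jump px t0 eta0; apply: filterS => n hn.
have gridS i : grid t n i <= grid t n i.+1 by apply: le_grid => //; exact: ltW.
have gridge0 i : 0 <= grid t n i by apply: grid_ge0; exact: ltW.
have cellfin i := esum_excess_fin (ltW d0) (gridge0 i) (gridS i).
have eE : fine (esum_excess delta 0 t) =
    \sum_(i < n.+1) fine (esum_excess delta (grid t n i) (grid t n i.+1)).
  apply: EFin_inj; rewrite fineK// -sumEFin -[X in esum_excess _ _ X](grid_last t n).
  by rewrite esum_excess_grid//; apply: eq_bigr => i _; rewrite fineK.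
rewrite eE distrC ger0_norm; last first.
  rewrite subr_ge0 ler_sum// => i _.
  by rewrite -lee_fin fineK// esum_excess_le// ltW.
apply: le_trans heta; rewrite lerBlDr -lerBlDr.
have <- : \sum_(i < n.+1) (x (grid t n i.+1) - x (grid t n i)) = x t.
  rewrite -(big_mkord xpredT (fun i => x (grid t n i.+1) - x (grid t n i))).
  by rewrite telescope_sumr// grid_last grid0 path0// subr0.
rewrite mulr_suml mulr_sumr -sumrB; apply: ler_sum => i _; rewrite lerBlDr.
have [s /andP[is_ si] hs] := hn i (ltn_ord i).
have js0 : 0 <= x (grid t n i.+1) - x (grid t n i) by rewrite subr_ge0 path_le.
rewrite (le_trans (excess_perturb d0 (ltW eta0) js0 hs))// addrC lerD2l.
by rewrite -lee_fin fineK// jump_le_esum_excess.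
Qed.

(** Finitely many jumps carry the total up to [e / 2], and on each of them the excess over [delta]
    loses at most [delta]. *)
Lemma cvg_esum_excess0 (t : R) : 0 < t ->
  fine (esum_excess delta 0 t) @[delta --> 0^'+] --> fine (esum_excess 0 0 t).
Proof.
move=> t0; apply/cvgrPdist_le => e e0.
have fin (delta : R) : 0 <= delta -> esum_excess delta 0 t \is a fin_num.
  by move=> d0; apply: esum_excess_fin => //; exact: ltW.
have : ((fine (esum_excess 0 0 t) - e / 2)%:E < esum_excess 0 0 t)%E.
  by rewrite -[ltRHS]fineK ?fin// lte_fin ltrBlDr ltrDl divr_gt0.
move=> /ereal_sup_gt[_ [F [finF FI] <-]].
rewrite fsbig_finite//= sumEFin lte_fin; set l := finmap.enum_fset _ => hF.
have lF s : s \in l -> s \in `]0, t].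
  by rewrite [_ \in l](in_fset_set finF) inE => /FI.
near=> delta.
have d0 : 0 < delta by near: delta; exact: nbhs_right_gt.
have le0 : fine (esum_excess delta 0 t) <= fine (esum_excess 0 0 t).
  rewrite fine_le ?fin ?(ltW d0)//; apply: le_esum => s /=.
  rewrite in_itv/= => /andP[s0 _]; rewrite lee_fin excess0 ?jump_ge0//.
  by rewrite -[leRHS](min_excess delta) lerDr le_min jump_ge0// ltW.
rewrite ger0_norm ?subr_ge0//.
have ge : \sum_(s <- l) excess delta (jump x s) <= fine (esum_excess delta 0 t).
  rewrite -lee_fin fineK ?fin ?(ltW d0)//; apply: esum_ge; exists F => //.
  by rewrite fsbig_finite//= sumEFin.
have : \sum_(s <- l) (excess 0 (jump x s) - delta) <=
    \sum_(s <- l) excess delta (jump x s).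
  rewrite big_seq [leRHS]big_seq; apply: ler_sum => s /lF.
  rewrite in_itv/= => /andP[s0 _].
  by rewrite excess0 ?jump_ge0// excessB_le// ltW.
rewrite sumrB big_const_seq count_predT iter_addr_0 => lt.
have : delta *+ size l <= e / 2.
  have dl : delta < e / 2 / (size l).+1%:R.
    by near: delta; apply: nbhs_right_lt; rewrite !divr_gt0.
  rewrite (@le_trans _ _ (delta *+ (size l).+1))//.
    by rewrite ler_wpMn2l// ltW.
  by rewrite -[leLHS]mulr_natr -ler_pdivlMr ?ltr0n// ltW.
move: lt ge hF; lra.
Unshelve. all: by end_near. Qed.

(** The sum of the shortened jumps as a real number, from min(a, delta) = a - (a - delta)^+;
    [esum_jump] proves the identification. *)
Definition jump_sum (delta t : R) : R :=
  fine (esum_excess 0 0 t) - fine (esum_excess delta 0 t).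

(** As [excess 0] leaves jumps unchanged, this is what remains of [x t] once all jumps are removed:
    the constant c of the overview. *)
Definition continuous_part (t : R) : R := x t - fine (esum_excess 0 0 t).

Lemma esum_jump (t delta : R) : 0 < t -> 0 < delta ->
  (\esum_(s in `]0%R, t]) (Num.min (jump x s) delta)%:E)%R =
  (jump_sum delta t)%:E.
Proof.
move=> t0 d0.
have fin (a : R) : 0 <= a -> esum_excess a 0 t \is a fin_num.
  by move=> a0; apply: esum_excess_fin => //; exact: ltW.
have : esum_excess 0 0 t = ((\esum_(s in `]0%R, t])
    (Num.min (jump x s) delta)%:E)%R + esum_excess delta 0 t)%E.
  rewrite /esum_excess -esumD.
  - apply: eq_esum => s /=; rewrite in_itv/= => /andP[s0 _].
    by rewrite -EFinD min_excess excess0// jump_ge0.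
  - move=> s /=; rewrite in_itv/= => /andP[s0 _].
    by rewrite lee_fin le_min jump_ge0// ltW.
  - by move=> s _; rewrite lee_fin excess_ge0.
rewrite /jump_sum EFinB !fineK ?fin ?(ltW d0)// => ->.
by rewrite addeK// fin// ltW.
Qed.

Lemma cvg_jump_sum0 (t : R) : 0 < t ->
  jump_sum delta t @[delta --> 0^'+] --> 0.
Proof.
move=> t0; rewrite -[X in _ --> X](subrr (fine (esum_excess 0 0 t))).
by apply: cvgB; [exact: cvg_cst|exact: cvg_esum_excess0].
Qed.

Lemma cvg_trunc_grid (t delta : R) : 0 < t -> 0 < delta ->
  \sum_(i < n.+1) trunc delta (x (grid t n i.+1) - x (grid t n i))
    @[n --> \oo] --> continuous_part t + jump_sum delta t.
Proof.
move=> t0 d0; rewrite /continuous_part /jump_sum addrA subrK.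
have -> : (fun n => \sum_(i < n.+1)
      trunc delta (x (grid t n i.+1) - x (grid t n i))) =
    (fun n => x t - \sum_(i < n.+1)
      excess delta (x (grid t n i.+1) - x (grid t n i))).
  apply/funext => n.
  have <- : \sum_(i < n.+1) (x (grid t n i.+1) - x (grid t n i)) = x t.
    rewrite -(big_mkord xpredT (fun i => x (grid t n i.+1) - x (grid t n i))).
    by rewrite telescope_sumr// grid_last grid0 path0// subr0.
  rewrite -sumrB; apply: eq_bigr => i _; apply: trunc_excess; first exact: ltW.
  by rewrite subr_ge0 path_le// ?grid_ge0 ?le_grid// ltW.
by apply: cvgB; [exact: cvg_cst|exact: cvg_excess_grid].
Qed.

End path_limit.

(** * Polynomial approximation *)

(* [bernstein n g] is \sum_k g k 'C(n, k) 'X^k (1 - 'X)^(n - k), the mean of g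
   under the binomial law with parameter 'X, defined by conditioning on the
   last trial. *)
Fixpoint bernstein (R : realType) (n : nat) (g : nat -> R) : {poly R} :=
  if n is m.+1 then
    'X * bernstein m (fun k => g k.+1) + (1 - 'X) * bernstein m g
  else (g 0%N)%:P.

Section bernstein_theory.
Context (R : realType).
Implicit Types (n : nat) (g h : nat -> R) (x : R).

Let bernsteinS n g x : (bernstein n.+1 g).[x] =
  x * (bernstein n (fun k => g k.+1)).[x] + (1 - x) * (bernstein n g).[x].
Proof. by rewrite /= !hornerE. Qed.

Lemma bernsteinD n g h x : (bernstein n (fun k => g k + h k)).[x] =
  (bernstein n g).[x] + (bernstein n h).[x].
Proof.
elim: n g h => [|n ih] g h; first by rewrite /= !hornerE.
by rewrite !bernsteinS !ih; ring.
Qed.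

Lemma bernsteinZ n c g x : (bernstein n (fun k => c * g k)).[x] =
  c * (bernstein n g).[x].
Proof.
elim: n g => [|n ih] g; first by rewrite /= !hornerE.
by rewrite !bernsteinS !ih; ring.
Qed.

Lemma bernstein_cst n c x : (bernstein n (fun=> c)).[x] = c.
Proof.
elim: n => [|n ih]; first by rewrite /= hornerE.
by rewrite bernsteinS ih; ring.
Qed.

(** The second moment of a binomial variable shifted by [c]. The shift is kept general because
    conditioning on the last trial replaces [c] by [c + 1]. *)
Lemma bernstein_sqr n c x : (bernstein n (fun k => (k%:R + c) ^+ 2)).[x] =
  (n%:R * x + c) ^+ 2 + n%:R * x * (1 - x).
Proof.
elim: n c => [|n ih] c; first by rewrite /= hornerE mul0r !add0r !mul0r addr0.
rewrite bernsteinS.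
have -> : (fun k : nat => (k.+1%:R + c) ^+ 2) = (fun k : nat => (k%:R + (c + 1)) ^+ 2).
  by apply/funext => k; rewrite -natr1; ring.
by rewrite !ih -natr1; ring.
Qed.

Lemma le_bernstein n g h x : 0 <= x <= 1 ->
  (forall k, (k <= n)%N -> g k <= h k) ->
  (bernstein n g).[x] <= (bernstein n h).[x].
Proof.
move=> /andP[x0 x1]; elim: n g h => [|n ih] g h gh.
  by rewrite /= !hornerE gh.
rewrite !bernsteinS lerD// ler_wpM2l ?subr_ge0// ih// => k kn; apply: gh => //.
exact: (leq_trans kn).
Qed.

(** Continuity handles close points; for distant ones a large [C] beats the oscillation of [f]. The
    error term is quadratic so that its binomial mean is a variance. *)
Lemma continuous_quadratic_modulus (f : R -> R) (e : R) :
  {within `[0, 1], continuous f} -> 0 < e ->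
  exists2 C, 0 <= C & forall x y, 0 <= x <= 1 -> 0 <= y <= 1 ->
    `|f x - f y| <= e + C * (x - y) ^+ 2.
Proof.
move=> cf e0.
have [c1 _ fc1] := EVT_max ler01 cf.
have [c2 _ fc2] := EVT_min ler01 cf.
pose Q (C x : R) := 0 <= x <= 1 -> forall y : R, 0 <= y <= 1 ->
    `|f x - f y| <= e + C * (x - y) ^+ 2.
have /compact_near_coveringP cov := @segment_compact R 0 1.
suff : \forall C \near +oo, `[0, 1] `<=` Q C.
  move=> h; near (pinfty_nbhs R) => C; exists C => [|x y x01 y01].
    by near: C; apply: nbhs_pinfty_ge; rewrite num_real.
  have : `[0, 1] `<=` Q C by near: C.
  by apply => //; rewrite /= in_itv.
apply: cov => /= x0; rewrite /= in_itv/= => x01.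
have [r r0 hr] : exists2 r : R, 0 < r &
    forall y : R, 0 <= y <= 1 -> `|x0 - y| < r -> `|f x0 - f y| < e / 2.
  have /subspace_continuousP/(_ x0) := cf; rewrite /= in_itv/= => /(_ x01).
  move=> /cvgrPdist_lt/(_ (e / 2)); rewrite divr_gt0// => /(_ isT)[r /= r0 hr].
  by exists r => // y y01 xy; apply: hr => //=; rewrite in_itv.
pose K := f c1 - f c2.
near=> x C; move=> /= x01' y y01.
have C0 : 0 <= C by near: C; apply: nbhs_pinfty_ge; rewrite num_real.
have xr : `|x0 - x| < r / 2.
  by near: x; apply: nbhsx_ballx; rewrite divr_gt0.
have CK : K / (r / 2) ^+ 2 <= C by near: C; apply: nbhs_pinfty_ge; rewrite num_real.
have [yr|ry] := ltP `|x0 - y| r.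
  have fx : `|f x0 - f x| < e / 2 by apply: hr => //; lra.
  have fy := hr _ y01 yr.
  have fxy : `|f x - f y| <= e.
    rewrite (_ : f x - f y = (f x0 - f y) - (f x0 - f x)); last by ring.
    apply: (le_trans (ler_normB _ _)); rewrite [e in leRHS]splitr.
    by apply: lerD; exact: ltW.
  apply: (le_trans fxy); rewrite lerDl.
  by apply: mulr_ge0 => //; exact: sqr_ge0.
have rxy : r / 2 <= `|x - y|.
  have : `|x0 - y| <= `|x0 - x| + `|x - y|.
    by rewrite -[in leLHS](subrK x x0) -addrA ler_normD.
  lra.
have : K <= C * (x - y) ^+ 2.
  rewrite ler_pdivrMr ?exprn_gt0 ?divr_gt0// in CK.
  apply: (le_trans CK); apply: ler_wpM2l => //.
  rewrite -[leRHS]real_normK ?num_real//.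
  apply: lerXn2r => //; rewrite nnegrE//.
  by rewrite divr_ge0// ltW.
have : `|f x - f y| <= K.
  have [h1 h2] : f x <= f c1 /\ f y <= f c1 by split; apply: fc1; rewrite in_itv.
  have [h3 h4] : f c2 <= f x /\ f c2 <= f y by split; apply: fc2; rewrite in_itv.
  by rewrite /K ler_norml; apply/andP; split; lra.
lra.
Unshelve. all: by end_near. Qed.

(** Bernstein's argument: the mean of the quadratic modulus is [e / 2] plus [C] times the variance x
    (1 - x) / n of a binomial frequency. *)
Lemma weierstrass (f : R -> R) (e : R) :
  {within `[0, 1], continuous f} -> 0 < e ->
  exists p : {poly R}, forall x, 0 <= x <= 1 -> `|f x - p.[x]| <= e.
Proof.
move=> cf e0.
have [C C0 fC] := continuous_quadratic_modulus cf (divr_gt0 e0 (ltr0n _ 2)).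
near \oo => n0.
have : C / n0.+1%:R <= e / 2.
  by apply: ltW; near: n0; apply: near_natSinv; rewrite divr_gt0.
set n := n0.+1 => Cn.
have n_gt0 : (0 : R) < n%:R by rewrite ltr0n.
exists (bernstein n (fun k => f (k%:R / n%:R))) => x x01.
have fk k : (k <= n)%N -> `|f x - f (k%:R / n%:R)| <=
    e / 2 + C / n%:R ^+ 2 * (k%:R + - (n%:R * x)) ^+ 2.
  move=> kn; apply: (le_trans (fC x (k%:R / n%:R) x01 _)).
    by rewrite divr_ge0//= ler_pdivrMr// mul1r ler_nat.
  rewrite lerD2l (_ : x - _ = - (k%:R + - (n%:R * x)) / n%:R); last first.
    by field; rewrite gt_eqF.
  by rewrite mulNr sqrrN expr_div_n mulrA mulrAC.
have bound : (bernstein n (fun k => e / 2 + C / n%:R ^+ 2 *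
    (k%:R + - (n%:R * x)) ^+ 2)).[x] <= e.
  rewrite bernsteinD bernstein_cst bernsteinZ bernstein_sqr subrr expr0n/= add0r.
  rewrite (_ : C / n%:R ^+ 2 * _ = C / n%:R * (x * (1 - x))); last by field; rewrite gt_eqF.
  have : C / n%:R * (x * (1 - x)) <= C / n%:R * 1.
    by rewrite ler_wpM2l ?divr_ge0 ?(ltW n_gt0)//; nra.
  lra.
rewrite ler_norml; apply/andP; split.
  rewrite lerBrDr addrC lerBlDr.
  rewrite -[X in _ <= X + _](bernstein_cst n (f x) x).
  apply: le_trans (lerD (lexx _) bound); rewrite -bernsteinD.
  apply: le_bernstein => // k kn.
  by have := fk k kn; rewrite ler_norml => /andP[]; lra.
rewrite lerBlDr addrC -[X in X <= _](bernstein_cst n (f x) x).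
apply: le_trans (lerD (lexx _) bound); rewrite -bernsteinD.
apply: le_bernstein => // k kn.
by have := fk k kn; rewrite ler_norml => /andP[]; lra.
Unshelve. all: by end_near. Qed.

End bernstein_theory.

(** * The Levy measure *)

(** Tonelli on the set of pairs with [0 <= y <= delta] and [y < x]: its section at [y] is a tail,
    and its section at [x > 0] has length min(x, delta). *)
Lemma integral_measure_tail (R : realType)
    (m : {sigma_finite_measure set R -> \bar R}) (delta : R) : 0 < delta ->
  (\int[lebesgue_measure]_(y in `[0%R, delta]) m `]y, +oo[%classic =
   \int[m]_(x in `]0%R, +oo[) (Num.min x delta)%:E)%E.
Proof.
move=> d0; pose A : set (R * R) := [set z | 0 <= z.2 <= delta /\ z.2 < z.1].
have mA : measurable A.
  have -> : A = [set: R] `*` `[0, delta] `&` [set z | z.2 < z.1].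
    apply/seteqP; split => -[a b] /=; rewrite in_itv/=.
      by move=> [].
    by move=> [[]].
  apply: measurableI; first exact: measurableX.
  rewrite -[X in measurable X]setTI.
  have -> : [set z : R * R | z.2 < z.1] = (fun z => z.2 < z.1) @^-1` [set true].
    by [].
  exact: (measurable_fun_ltr measurable_snd measurable_fst).
pose f : R * R -> \bar R := EFin \o \1_A.
have mf : measurable_fun setT f by exact/measurable_EFinP/measurable_indic.
have f0 z : (0 <= f z)%E by rewrite lee_fin.
have fub := @fubini_tonelli _ _ _ _ R m lebesgue_measure f mf f0.
rewrite [LHS]integral_mkcond [RHS]integral_mkcond.
transitivity (\int[lebesgue_measure]_y (\int[m]_x f (x, y)))%E.
  apply: eq_integral => y _; rewrite /f /= patchE.
  have [/set_mem|y0] := ifPn; rewrite /= ?in_itv/=.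
    move=> y0d; rewrite -[in LHS](setIT `]y, +oo[%classic) -integral_indic//.
    apply: eq_integral => x _; congr (_%:E).
    rewrite !indicE; congr (_ : bool)%:R; apply/idP/idP; rewrite !inE/= in_itv/= andbT.
      by split.
    by case.
  rewrite integral0_eq// => x _; rewrite indicE memNset// => -[y0d _].
  by move: y0; rewrite notin_setE/= in_itv/=.
rewrite -{}fub; apply: eq_integral => x _; rewrite patchE.
have -> : (fun y => f (x, y)) = EFin \o \1_(`[0, delta] `&` `]-oo, x[).
  by apply/funext => y; congr (_%:E); rewrite !indicE; congr (_ : bool)%:R.
rewrite integral_indic ?setIT//; last exact: measurableI.
case: ifPn => [/set_mem|/negP x0].
  rewrite /= in_itv/= andbT => x0.
  have [dx|xd] := ltP delta x.
    have -> : `[0, delta] `&` `]-oo, x[ = `[0, delta]%classic.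
      apply/setIidl => y /=; rewrite !in_itv/= => /andP[_ yd].
      exact: le_lt_trans dx.
    by rewrite lebesgue_measure_itv/= lte_fin d0 oppr0 adde0.
  have -> : `[0, delta] `&` `]-oo, x[ = `[0, x[%classic.
    apply/seteqP; split => y /=; rewrite !in_itv/=; first by case=> /andP[-> _] ->.
    by move=> /andP[-> yx]; rewrite yx (le_trans (ltW yx)).
  by rewrite lebesgue_measure_itv/= lte_fin x0 oppr0 adde0.
have x_le0 : x <= 0.
  by rewrite leNgt; apply/negP => xp; apply: x0; rewrite inE/= in_itv/= xp.
have -> : `[0, delta] `&` `]-oo, x[ = set0; last by rewrite measure0.
apply/seteqP; split => // y /=; rewrite !in_itv/= => -[/andP[y0 _] yx].
by have := lt_le_trans yx x_le0; rewrite ltNge y0.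
Qed.

Section sigma_finite_measure_of.
Context d (T : measurableType d) (R : realType).
Context (m : {measure set T -> \bar R}) (sfm : sigma_finite setT m).

(** A copy of [m] indexed by the proof, so that the structure of a sigma-finite measure can be
    attached to it. *)
Definition sigma_finite_of of sigma_finite setT m : set T -> \bar R := m.

HB.instance Definition _ := Measure.on (sigma_finite_of sfm).
HB.instance Definition _ :=
  Measure_isSigmaFinite.Build _ _ _ (sigma_finite_of sfm) sfm.

End sigma_finite_measure_of.

Section levy_measure_theory.
Context (R : realType) (Pi : {measure set R -> \bar R}).
Hypothesis levyPi : levy_measure Pi.

Local Notation pos := (`]0%R, +oo[%classic : set R).

Let mpos : measurable pos. Proof. exact: measurable_itv. Qed.

Lemma levy_integrable_min1 : Pi.-integrable pos (EFin \o Num.min 1).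
Proof.
apply/integrableP; split.
  apply/measurable_EFinP; apply: measurable_minr => //.
case: levyPi => _; apply: le_lt_trans; apply: ge0_le_integral => //.
- do 2 apply: measurableT_comp => //; exact: measurable_minr.
- apply/measurable_EFinP; exact: measurable_minr.
- move=> x; rewrite /= in_itv/= andbT => x0.
  by rewrite ger0_norm// le_min ler01/= ltW.
Qed.

Lemma levy_integrable (C : R) (f : R -> R) : measurable_fun pos f ->
  (forall x, 0 < x -> `|f x| <= C * Num.min 1 x) ->
  Pi.-integrable pos (EFin \o f).
Proof.
move=> mf fC; have := integrableZl mpos C levy_integrable_min1.
apply: le_integrable => //; first exact/measurable_EFinP.
move=> x /=; rewrite in_itv/= andbT => x0.
by rewrite lee_fin (le_trans (fC x x0))// ler_norm.
Qed.

Lemma levy_integrable_min (delta : R) : 0 <= delta ->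
  Pi.-integrable pos (EFin \o (Num.min^~ delta)).
Proof.
move=> d0; apply: (@levy_integrable (Num.max 1 delta)).
  exact: measurable_minr.
move=> x x0; rewrite ger0_norm ?le_min ?(ltW x0)//.
rewrite -[leRHS]mulrC.
have m1 : 1 <= Num.max 1 delta by rewrite le_max lexx.
have md : delta <= Num.max 1 delta by rewrite le_max lexx orbT.
have [x1|x1] := leP 1 x; first by rewrite mul1r ge_min md orbT.
by rewrite ge_min ler_peMr// ltW.
Qed.

(** Markov's inequality for min(1, x), which is at least [c] on the tail. *)
Lemma levy_tail_fin (y : R) : 0 < y -> (Pi `]y, +oo[%classic < +oo)%E.
Proof.
move=> y0; pose c := Num.min 1 y.
have c0 : 0 < c by rewrite lt_min ltr01.
have sub : `]y, +oo[%classic `<=` pos.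
  by move=> x /=; rewrite !in_itv/= !andbT; exact: lt_trans.
have : (c%:E * Pi `]y, +oo[%classic <= \int[Pi]_(x in pos) (Num.min 1 x)%:E)%E.
  rewrite -integral_cst//.
  apply: (@le_trans _ _ (\int[Pi]_(x in `]y, +oo[) (Num.min 1 x)%:E)%E).
    apply: ge0_le_integral => //.
    - by move=> x _; rewrite lee_fin ltW.
    - by apply/measurable_EFinP; exact: measurable_minr.
    - move=> x /=; rewrite in_itv/= andbT => yx; rewrite lee_fin /c.
      by rewrite le_min !ge_min lexx/= (ltW yx) orbT.
  apply: ge0_subset_integral => //.
    by apply/measurable_EFinP; exact: measurable_minr.
  move=> x /=; rewrite in_itv/= andbT => x0.
  by rewrite lee_fin le_min ler01 ltW.
move=> /le_lt_trans/(_ (proj2 levyPi)).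
by case: (Pi _) => [r| |]//; rewrite ?ltry// mulry gtr0_sg// mul1e.
Qed.

Lemma levy_sigma_finite : sigma_finite setT Pi.
Proof.
exists (fun n => `]-oo, 0] `|` `]n.+1%:R^-1, +oo[).
  apply/seteqP; split => // x _.
  have [x0|x0] := leP x 0; first by exists 0%N => //; left; rewrite /= in_itv.
  near \oo => n; exists n => //; right; rewrite /= in_itv/= andbT.
  by rewrite -[X in X < _]div1r; near: n; exact: near_natSinv.
move=> n /=; split; first exact: measurableU.
apply: (le_lt_trans (measureU2 _ _ _)) => //.
by rewrite [X in (X + _)%E](proj1 levyPi) add0e levy_tail_fin// invr_gt0.
Unshelve. all: by end_near. Qed.

(** The quantity I(delta) in layer-cake form (see [tail_integralE]). Monotonicity, concavity and the
    limit at 0 can then be read off the integrand. *)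
Definition levy_tail_mean (delta : R) : R :=
  \int[Pi]_(x in pos) Num.min x delta.

Local Notation I := levy_tail_mean.

Lemma levy_tail_mean_EFin (delta : R) : 0 <= delta ->
  ((I delta)%:E = \int[Pi]_(x in pos) (Num.min x delta)%:E)%E.
Proof.
move=> d0; rewrite fineK//.
exact: (integrable_fin_num mpos (levy_integrable_min d0)).
Qed.

Lemma tail_integralE (delta : R) : 0 < delta -> tail_integral Pi delta = (I delta)%:E.
Proof.
move=> d0; rewrite levy_tail_mean_EFin ?ltW//.
exact: (@integral_measure_tail _ (sigma_finite_of levy_sigma_finite)).
Qed.

Lemma muE (drift delta : R) : 0 < delta ->
  mu drift Pi delta = ((drift + I delta) / delta)%:E.
Proof. by move=> d0; rewrite /mu tail_integralE// -EFinD -EFinM mulrC. Qed.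

Lemma levy_tail_mean_ge0 (delta : R) : 0 <= delta -> 0 <= I delta.
Proof.
move=> d0; apply: Rintegral_ge0 => x /=; rewrite in_itv/= andbT => x0.
by rewrite le_min d0 ltW.
Qed.

Lemma le_levy_tail_mean (a b : R) : 0 <= a -> a <= b -> I a <= I b.
Proof.
move=> a0 ab; apply: le_Rintegral => //.
- exact: levy_integrable_min.
- by apply: levy_integrable_min; exact: le_trans ab.
- by move=> x _; rewrite le_min !ge_min lexx/= ab orbT.
Qed.

(** This says that I(delta) / delta is nonincreasing, without division; it holds pointwise, since
    [Num.min x] is concave and vanishes at 0 for [x > 0]. *)
Lemma levy_tail_mean_concave (a b : R) : 0 <= a -> a <= b -> a * I b <= b * I a.
Proof.
move=> a0 ab; have b0 := le_trans a0 ab.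
rewrite -!RintegralZl//; try exact: levy_integrable_min.
have iZ (c e : R) : 0 <= e -> Pi.-integrable pos (EFin \o (fun x => c * Num.min x e)).
  by move=> e0; have := integrableZl mpos c (levy_integrable_min e0).
apply: le_Rintegral => //; [exact: iZ|exact: iZ|].
move=> x /=; rewrite in_itv/= andbT => x0.
by case: (leP x a) => ?; case: (leP x b) => ?; nra.
Qed.

(** Dominated convergence along 1 / (n + 1), with min(1, x) as the dominating function, then
    monotonicity. *)
Lemma cvg_levy_tail_mean0 : I delta @[delta --> 0^'+] --> 0.
Proof.
have cinv : (n.+1%:R^-1 : R) @[n --> \oo] --> 0.
  apply/cvgrPdist_lt => e e0; near=> n.
  rewrite sub0r normrN ger0_norm// -[X in X < _]div1r.
  by near: n; exact: near_natSinv.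
have inv1 n : (n.+1%:R^-1 : R) <= 1 by rewrite invf_le1// ler1n.
have cI : I n.+1%:R^-1 @[n --> \oo] --> 0.
  have : (\int[Pi]_(x in pos) (Num.min x n.+1%:R^-1)%:E)%E @[n --> \oo] -->
      (\int[Pi]_(x in pos) (cst 0 x)%:E)%E.
    apply: (@dominated_cvg _ _ _ _ _ mpos _ _ (EFin \o Num.min 1)) => //.
    - by move=> n; apply/measurable_EFinP; exact: measurable_minr.
    - move=> x /=; rewrite in_itv/= andbT => x0; apply: cvg_EFin.
        by near=> n.
      apply/cvgrPdist_lt => e e0; near=> n.
      rewrite sub0r normrN ger0_norm; last by rewrite le_min (ltW x0) invr_ge0/=.
      rewrite gt_min -[X in _ || (X < _)]div1r; apply/orP; right.
      by near: n; exact: near_natSinv.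
    - exact: levy_integrable_min1.
    - move=> n x /=; rewrite in_itv/= andbT => x0.
      rewrite lee_fin ger0_norm; last by rewrite le_min (ltW x0) invr_ge0/=.
      by rewrite /= le_min !ge_min lexx inv1 orbT.
  rewrite integral0 => /fine_cvgP[_].
  by apply: cvg_trans; apply: near_eq_cvg; near=> n.
apply/cvgrPdist_lt => e e0.
have /cvgrPdist_lt/(_ e e0)[n _ /(_ n (leqnn _))] /= := cI.
rewrite sub0r normrN => In; near=> delta.
have d0 : 0 < delta by near: delta; exact: nbhs_right_gt.
have dn : delta < n.+1%:R^-1.
  by near: delta; apply: nbhs_right_lt; rewrite invr_gt0.
rewrite sub0r normrN ger0_norm ?levy_tail_mean_ge0 ?ltW//.
apply: le_lt_trans In.
rewrite ger0_norm ?levy_tail_mean_ge0//.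
by apply: le_levy_tail_mean; exact: ltW.
Unshelve. all: by end_near. Qed.

(** I(delta) / delta is at least [Pi] of the tail beyond delta, and the tails increase to the whole
    half-line. *)
Lemma levy_tail_mean_unbounded (A : R) : Pi pos = +oo%E ->
  exists2 delta, 0 < delta & A * delta <= I delta.
Proof.
move=> Pioo; pose F n := `]n.+1%:R^-1, +oo[%classic : set R.
have UF : \bigcup_n F n = pos.
  apply/seteqP; split => x /=.
    by move=> [n _]; rewrite /F /= !in_itv/= !andbT; apply: lt_trans; rewrite invr_gt0.
  rewrite in_itv/= andbT => x0.
  near \oo => n; exists n => //; rewrite /F/= in_itv/= andbT.
  by rewrite -[X in X < _]div1r; near: n; exact: near_natSinv.
have mF n : measurable (F n) by exact: measurable_itv.
have ndF : {homo F : n m / (n <= m)%N >-> (n <= m)%O}.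
  move=> n m nm; apply/subsetPset => x; rewrite /F/= !in_itv/= !andbT.
  by apply: le_lt_trans; rewrite lef_pV2 ?posrE// ler_nat.
have := nondecreasing_cvg_mu mF; rewrite UF => /(_ R Pi mpos ndF).
rewrite Pioo => /cvgeyPge/(_ A)[n _ /(_ n (leqnn _))] /= hn.
exists n.+1%:R^-1; first by rewrite invr_gt0.
rewrite -lee_fin EFinM muleC levy_tail_mean_EFin//.
apply: (@le_trans _ _ (n.+1%:R^-1%:E * Pi (F n))%E).
  by rewrite lee_pmul2l// lte_fin invr_gt0.
rewrite -integral_cst//.
apply: (@le_trans _ _ (\int[Pi]_(x in F n) (Num.min x n.+1%:R^-1)%:E)%E).
  apply: ge0_le_integral => //.
  - by move=> x _; rewrite lee_fin invr_ge0.
  - by apply/measurable_EFinP; exact: measurable_minr.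
  - by move=> x; rewrite /F/= in_itv/= andbT => xn; rewrite lee_fin le_min lexx ltW.
apply: ge0_subset_integral => //.
- by apply/measurable_EFinP; exact: measurable_minr.
- by move=> x /=; rewrite in_itv/= andbT => x0; rewrite lee_fin le_min (ltW x0) invr_ge0/=.
- by rewrite -UF; apply: bigcup_sup.
Unshelve. all: by end_near. Qed.

End levy_measure_theory.

(** * Increments *)

Section independent_pair.
Context (R : realType) d (T : measurableType d) (P : probability T R).
Context (xi zeta : {mfun T >-> R}).

(** The joint law agrees with the product of the marginals on rectangles, hence everywhere, and
    Tonelli applies. *)
Lemma integral_independent (f g : R -> \bar R) :
  (forall A B, measurable A -> measurable B ->
    P (xi @^-1` A `&` zeta @^-1` B) = (P (xi @^-1` A) * P (zeta @^-1` B))%E) ->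
  measurable_fun setT f -> measurable_fun setT g ->
  (forall x, 0 <= f x)%E -> (forall x, 0 <= g x)%E ->
  (\int[P]_w (f (xi w) * g (zeta w)) =
   \int[P]_w f (xi w) * \int[P]_w g (zeta w))%E.
Proof.
move=> ind mf mg f0 g0.
have mpair : measurable_fun setT (fun w => (xi w, zeta w)).
  by apply: measurable_fun_pair.
pose pair_mixin := isMeasurableFun.Build _ _ _ _ _ mpair.
pose pair : {mfun T >-> (R * R)%type} :=
  HB.pack (fun w => (xi w, zeta w)) pair_mixin.
pose h (z : R * R) := (f z.1 * g z.2)%E.
have mh : measurable_fun setT h.
  by apply: emeasurable_funM; apply: measurableT_comp.
have h0 z : (0 <= h z)%E by rewrite mule_ge0.
have -> : (\int[P]_w (f (xi w) * g (zeta w)) = \int[distribution P pair]_z h z)%E.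
  by rewrite ge0_integral_pushforward// => z _; exact: h0.
transitivity (\int[distribution P xi]_x fubini_F (distribution P zeta) h x)%E.
  rewrite -(@fubini_tonelli1 _ _ _ _ _ (distribution P xi) (distribution P zeta) h mh h0).
  apply: eq_measure_integral => A mA _; apply/esym.
  exact: product_measure_unique.
rewrite /fubini_F /h /=.
under eq_integral => x _ do rewrite ge0_integralZl//.
rewrite ge0_integralZr//; last exact: integral_ge0.
by congr (_ * _)%E; rewrite ge0_integral_pushforward.
Qed.

End independent_pair.

Lemma eq_integral_pushforward (R : realType) d (T : measurableType d)
    (P : probability T R) (xi zeta : {mfun T >-> R}) (f : R -> \bar R) :
  (forall A, measurable A -> P (xi @^-1` A) = P (zeta @^-1` A)) ->
  measurable_fun setT f -> (forall x, 0 <= f x)%E ->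
  (\int[P]_w f (xi w) = \int[P]_w f (zeta w))%E.
Proof.
move=> eqd mf f0.
transitivity (\int[distribution P xi]_x f x)%E.
  by rewrite ge0_integral_pushforward.
rewrite (@eq_measure_integral _ _ _ _ (distribution P zeta)); last first.
  by move=> A mA _; exact: eqd.
by rewrite ge0_integral_pushforward.
Qed.

Section increments.
Context (R : realType) d (T : measurableType d) (P : probability T R).
Context (X : R -> {RV P >-> R}).

Definition increment (s t : R) (w : T) : R := X t w - X s w.

Lemma measurable_increment (s t : R) : measurable_fun setT (increment s t).
Proof. exact: measurable_funB. Qed.

HB.instance Definition _ (s t : R) :=
  isMeasurableFun.Build _ _ _ _ (increment s t) (measurable_increment s t).

Hypothesis subX : subordinator X.

Lemma increment_independent (a b c e : R) (A B : set R) :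
  0 <= a -> a <= b -> b <= c -> c <= e -> measurable A -> measurable B ->
  P (increment a b @^-1` A `&` increment c e @^-1` B) =
  (P (increment a b @^-1` A) * P (increment c e @^-1` B))%E.
Proof.
move=> a0 ab bc ce mA mB.
(* The default value [e] of [nth] supplies the fourth time. The middle increment, from [b] to [c],
   is left free by the event [setT]. *)
have ht i : (i < 3)%N -> nth e [:: a; b; c] i <= nth e [:: a; b; c] i.+1.
  by case: i => [|[|[|]]].
have hB i : (i < 3)%N -> measurable (nth setT [:: A; setT; B] i).
  by case: i => [|[|[|]]] //= _; exact: measurableT.
have := subordinator_independent subX (n := 3) a0 ht hB.
rewrite !big_ord_recr big_ord0/= mul1e.
rewrite [X in (_ * P X * _)%E](_ : _ = setT); last by apply/seteqP; split.
rewrite probability_setT mule1 => <-; congr (P _).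
apply/seteqP; split => w /=.
  by move=> [? ?]; case=> [|[|[|]]].
by move=> h; split; [exact: (h 0%N)|exact: (h 2%N)].
Qed.

Lemma integral_increment_independent (a b c e : R) (f g : R -> \bar R) :
  0 <= a -> a <= b -> b <= c -> c <= e ->
  measurable_fun setT f -> measurable_fun setT g ->
  (forall x, 0 <= f x)%E -> (forall x, 0 <= g x)%E ->
  (\int[P]_w (f (increment a b w) * g (increment c e w)) =
   \int[P]_w f (increment a b w) * \int[P]_w g (increment c e w))%E.
Proof.
move=> a0 ab bc ce mf mg f0 g0; apply: integral_independent => // A B mA mB.
exact: increment_independent.
Qed.

Lemma integral_increment_stationary (s h : R) (f : R -> \bar R) :
  0 <= s -> 0 <= h -> measurable_fun setT f -> (forall x, 0 <= f x)%E ->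
  (\int[P]_w f (increment s (s + h) w) = \int[P]_w f (increment 0 h w))%E.
Proof.
move=> s0 h0 mf f0; apply: eq_integral_pushforward => // A mA.
exact: (subordinator_stationary subX s0 h0 mA).
Qed.

End increments.

(** * Mean and variance of the truncated sums *)

Section truncated_sum.
Context (R : realType) d (T : measurableType d) (P : probability T R).
Context (X : R -> {RV P >-> R}) (subX : subordinator X).

Lemma trunc_ge0 (delta a : R) : 0 <= trunc delta a.
Proof. by rewrite /trunc le_max lexx orbT. Qed.

Lemma trunc_le (delta a : R) : 0 <= delta -> trunc delta a <= delta.
Proof. by move=> d0; rewrite /trunc ge_max d0 ge_min lexx orbT. Qed.

Lemma measurable_trunc (delta : R) : measurable_fun setT (trunc delta).
Proof.
have -> : trunc delta = (id \min cst delta) \max cst 0 by [].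
apply: measurable_maxr; last exact: measurable_cst.
by apply: measurable_minr; [exact: measurable_id|exact: measurable_cst].
Qed.

Definition truncated_sum (t delta : R) (n : nat) (w : T) : R :=
  \sum_(i < n.+1) trunc delta (increment X (grid t n i) (grid t n i.+1) w).

Definition mean_trunc (h delta : R) : R :=
  \int[P]_w trunc delta (increment X 0 h w).

Context (t delta : R) (t0 : 0 < t) (delta0 : 0 < delta).

Let f : R -> \bar R := EFin \o trunc delta.

Let mf : measurable_fun setT f.
Proof. by apply/measurable_EFinP; exact: measurable_trunc. Qed.

Let f0 x : (0 <= f x)%E. Proof. by rewrite lee_fin trunc_ge0. Qed.

Let mfincr (a b : R) : measurable_fun setT (fun w => f (increment X a b w)).
Proof. exact: (measurableT_comp mf (measurable_increment X a b)). Qed.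

Lemma mean_truncE (h : R) :
  (\int[P]_w (trunc delta (increment X 0 h w))%:E = (mean_trunc h delta)%:E)%E.
Proof.
rewrite /mean_trunc /Rintegral fineK// ge0_fin_numE; last first.
  by apply: integral_ge0 => w _; exact: f0.
apply: (@le_lt_trans _ _ (\int[P]_w (cst delta%:E w))%E).
  apply: ge0_le_integral => //.
  - by move=> w _; exact: f0.
  - exact: mfincr.
  - by move=> w _; rewrite lee_fin trunc_le// ltW.
by rewrite integral_cst// [X in (_ * X)%E]probability_setT mule1 ltry.
Qed.

Lemma mean_trunc_ge0 (h : R) : 0 <= mean_trunc h delta.
Proof. by apply: Rintegral_ge0 => w _; exact: trunc_ge0. Qed.

Let grid_ge n i : 0 <= grid t n i.
Proof. exact/grid_ge0/ltW. Qed.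

Let integral_f n i : (\int[P]_w f (increment X (grid t n i) (grid t n i.+1) w) =
  (mean_trunc (t / n.+1%:R) delta)%:E)%E.
Proof.
rewrite grid_step integral_increment_stationary//; first exact: mean_truncE.
by rewrite divr_ge0// ltW.
Qed.

(** The square of the mean is kept on the diagonal as well, so that the double sum is exactly
    [M n ^+ 2 + delta * M n]. *)
Let integral_ff n (i j : nat) :
  (\int[P]_w (f (increment X (grid t n i) (grid t n i.+1) w) *
              f (increment X (grid t n j) (grid t n j.+1) w)) <=
  (mean_trunc (t / n.+1%:R) delta ^+ 2 +
   (i == j)%:R * (delta * mean_trunc (t / n.+1%:R) delta))%:E)%E.
Proof.
have le k l : (k <= l)%N -> grid t n k <= grid t n l.
  by move=> kl; apply: le_grid => //; exact: ltW.
case: (ltngtP i j) => [ij|ji|->].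
- rewrite integral_increment_independent//; [|exact: le..].
  by rewrite !integral_f mul0r addr0 expr2.
- under eq_integral do rewrite muleC.
  rewrite integral_increment_independent//; [|exact: le..].
  by rewrite !integral_f mul0r addr0 expr2.
- rewrite mul1r; apply: (@le_trans _ _ (delta * mean_trunc (t / n.+1%:R) delta)%:E).
    rewrite EFinM -(integral_f n j) -ge0_integralZl//; last first.
      by rewrite lee_fin ltW.
    apply: ge0_le_integral => //.
    + by move=> w _; rewrite mule_ge0.
    + exact: emeasurable_funM.
    + exact: emeasurable_funM.
    + by move=> w _; rewrite lee_wpmul2r// lee_fin trunc_le// ltW.
  by rewrite lee_fin lerDr sqr_ge0.
Qed.

Let M n := n.+1%:R * mean_trunc (t / n.+1%:R) delta.

Lemma measurable_truncated_sum n : measurable_fun setT (truncated_sum t delta n).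
Proof.
apply: measurable_sum => i; apply: measurableT_comp.
  exact: measurable_trunc.
exact: measurable_increment.
Qed.

Let mS := measurable_truncated_sum.

Let S_ge0 n w : 0 <= truncated_sum t delta n w.
Proof. by apply: sumr_ge0 => i _; exact: trunc_ge0. Qed.

Let M_ge0 n : 0 <= M n. Proof. by rewrite mulr_ge0// mean_trunc_ge0. Qed.

Lemma integral_truncated_sum n :
  (\int[P]_w (truncated_sum t delta n w)%:E = (M n)%:E)%E.
Proof.
under eq_integral do rewrite -sumEFin.
rewrite ge0_integral_sum//; last 2 first.
- by move=> i; exact: mfincr.
- by move=> i w _; exact: f0.
under eq_bigr do rewrite integral_f.
by rewrite sumEFin big_const_ord iter_addr_0 /M mulr_natl.
Qed.

Lemma integral_sqr_truncated_sum n :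
  (\int[P]_w (truncated_sum t delta n w ^+ 2)%:E <=
   (M n ^+ 2 + delta * M n)%:E)%E.
Proof.
have -> : (\int[P]_w (truncated_sum t delta n w ^+ 2)%:E =
    \int[P]_w (\sum_(i < n.+1) \sum_(j < n.+1)
      (f (increment X (grid t n i) (grid t n i.+1) w) *
       f (increment X (grid t n j) (grid t n j.+1) w))))%E.
  apply: eq_integral => w _; rewrite expr2 /truncated_sum mulr_suml -sumEFin.
  by apply: eq_bigr => i _; rewrite mulr_sumr -sumEFin.
have mff (i j : 'I_n.+1) : measurable_fun setT (fun w =>
    (f (increment X (grid t n i) (grid t n i.+1) w) *
       f (increment X (grid t n j) (grid t n j.+1) w))%E).
  exact: emeasurable_funM.
rewrite ge0_integral_sum//; last 2 first.
- by move=> i; exact: emeasurable_sum.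
- by move=> i w _; apply: sume_ge0 => j _; rewrite mule_ge0.
apply: (@le_trans _ _ (\sum_(i < n.+1) (\sum_(j < n.+1)
   (mean_trunc (t / n.+1%:R) delta ^+ 2 +
   ((i : nat) == j)%:R * (delta * mean_trunc (t / n.+1%:R) delta)))%:E)%E).
  apply: lee_sum => i _; rewrite ge0_integral_sum//; last first.
    by move=> j w _; rewrite mule_ge0.
  by rewrite -sumEFin; apply: lee_sum => j _; exact: integral_ff.
rewrite sumEFin lee_fin.
set e := mean_trunc _ _.
rewrite (eq_bigr (fun=> n.+1%:R * e ^+ 2 + delta * e)); last first.
  move=> i _; rewrite big_split/= big_const_ord iter_addr_0 mulr_natl.
  congr (_ + _); rewrite (bigD1 i)//= eqxx mul1r big1 ?addr0// => j ji.
  rewrite (_ : (i : nat) == j = false) ?mul0r//.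
  by apply/negbTE; move: ji; rewrite -val_eqE eq_sym.
rewrite big_const_ord iter_addr_0 -mulr_natl /M -/e; nra.
Qed.

Lemma variance_truncated_sum n :
  (\int[P]_w ((truncated_sum t delta n w - M n) ^+ 2)%:E <= (delta * M n)%:E)%E.
Proof.
have mS2 : measurable_fun setT (fun w => (truncated_sum t delta n w ^+ 2)%:E).
  exact/measurable_EFinP/measurable_funX.
have M2_ge0 : 0 <= 2 * M n by rewrite mulr_ge0.
(* The square is expanded with the cross term moved to the left, so that only nonnegative functions
   are integrated and nothing is subtracted in [\bar R]. *)
have key : (\int[P]_w ((truncated_sum t delta n w - M n) ^+ 2)%:E +
    ((2 * M n) * M n)%:E = \int[P]_w (truncated_sum t delta n w ^+ 2)%:E +
    (M n ^+ 2)%:E)%E.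
  have -> : ((M n ^+ 2)%:E = \int[P]_w (cst (M n ^+ 2)%:E w))%E.
    by rewrite integral_cst// [X in (_ * X)%E]probability_setT mule1.
  rewrite EFinM -integral_truncated_sum -ge0_integralZl//; last 2 first.
  - exact/measurable_EFinP.
  - by move=> w _; rewrite lee_fin.
  rewrite -!ge0_integralD//.
  - by apply: eq_integral => w _; rewrite -EFinM -!EFinD; congr (_%:E); ring.
  - by move=> w _; rewrite lee_fin sqr_ge0.
  - by move=> w _; rewrite lee_fin sqr_ge0.
  - by move=> w _; rewrite lee_fin sqr_ge0.
  - apply/measurable_EFinP/measurable_funX; exact: measurable_funB.
  - by move=> w _; apply: mule_ge0; rewrite lee_fin.
  - by apply: measurable_funeM; exact/measurable_EFinP.
rewrite -(@leeD2rE _ ((2 * M n) * M n)%:E)// key.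
apply: (le_trans (leeD2r _ (integral_sqr_truncated_sum n))).
by rewrite -!EFinD lee_fin le_eqVlt; apply/orP; left; apply/eqP; ring.
Qed.

End truncated_sum.

(** The values at integers come from [phi 1]. For other [h], the power [phi h ^+ n] is
    [phi (n%:R * h)], which monotonicity squeezes between the values at two consecutive integers;
    the exponent of [phi h] is thus [h * c] up to [c / n]. *)
Lemma expR_of_multiplicative (R : realType) (phi : R -> R) (c : R) :
  (forall a b, 0 <= a -> 0 <= b -> phi (a + b) = phi a * phi b) ->
  (forall a b, 0 <= a -> a <= b -> phi b <= phi a) ->
  phi 1 = expR (- c) ->
  forall h, 0 <= h -> phi h = expR (- (h * c)).
Proof.
move=> phiD ndphi phi1 h h0.
have phi0 : phi 0 = 1.
  apply: (mulfI (lt0r_neq0 (expR_gt0 (- c)))).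
  by rewrite -phi1 mulr1 -phiD ?addr0.
have c0 : 0 <= c.
  have := ndphi 0 1 (lexx 0) ler01; rewrite phi0 phi1 -expR0 ler_expR.
  by rewrite oppr_le0.
have phiX a n : 0 <= a -> phi (n%:R * a) = phi a ^+ n.
  move=> a0; elim: n => [|n ih]; first by rewrite mul0r phi0.
  by rewrite -natr1 mulrDl mul1r phiD ?mulr_ge0// ih exprSr.
have phin n : phi n%:R = expR (- (n%:R * c)).
  by rewrite -[n%:R]mulr1 phiX// phi1 mulr1 -mulrN expRM_natl.
have phih0 : 0 < phi h.
  have /andP[_ /ltW hk] := truncn_itv h0.
  by rewrite (lt_le_trans _ (ndphi _ _ h0 hk))// phin expR_gt0.
pose y := - ln (phi h).
have yE : phi h = expR (- y) by rewrite /y opprK lnK.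
suff -> : h * c = y by [].
apply/eqP; rewrite -subr_eq0 -normr_le0; apply/ler_addgt0Pr => e e0; rewrite add0r.
near \oo => n; have cn : c / n.+1%:R < e by near: n; exact: near_natSinv.
apply/ltW/(le_lt_trans _ cn); rewrite ler_pdivlMr// -[X in _ * X]ger0_norm//.
rewrite -normrM.
have nh0 : 0 <= n.+1%:R * h by rewrite mulr_ge0.
have /andP[kn nk] := truncn_itv nh0.
have := ndphi _ _ nh0 (ltW nk); have := ndphi _ _ (ler0n _ _) kn.
rewrite phiX// yE -expRM_natl !phin !ler_expR.
set N := n.+1%:R in nk kn *; set k := Num.truncn _ in nk kn *.
rewrite -natr1 in nk *.
have p1 := ler_wpM2r c0 kn; have p2 := ler_wpM2r c0 (ltW nk).
by rewrite ler_norml => ? ?; apply/andP; split; lra.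
Unshelve. all: by end_near. Qed.

(** * Laplace transforms of the increments *)

Section laplace.
Context (R : realType) d (T : measurableType d) (P : probability T R).
Context (X : R -> {RV P >-> R}) (subX : subordinator X).

(** This is exp(-k x) for [x >= 0]. As in [trunc], the maximum keeps it bounded on negative
    arguments, here by 1. *)
Definition damping (k : nat) (x : R) : R := expR (- Num.max x 0) ^+ k.

Lemma damping_gt0 k (x : R) : 0 < damping k x.
Proof. by rewrite exprn_gt0// expR_gt0. Qed.

Lemma damping_le1 k (x : R) : damping k x <= 1.
Proof.
rewrite exprn_ile1 ?expR_ge0// -expR0 ler_expR oppr_le0.
by rewrite le_max lexx orbT.
Qed.

Lemma measurable_damping k : measurable_fun setT (damping k).
Proof.
apply: measurable_funX; apply: measurableT_comp; first exact: measurable_expR.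
apply: measurableT_comp; first exact: oppr_measurable.
by apply: measurable_maxr; [exact: measurable_id|exact: measurable_cst].
Qed.

Lemma damping_ge0E k (x : R) : 0 <= x -> damping k x = expR (- (k%:R * x)).
Proof. by move=> x0; rewrite /damping max_l// -mulrN expRM_natl. Qed.

Lemma dampingD k (x y : R) : 0 <= x -> 0 <= y ->
  damping k (x + y) = damping k x * damping k y.
Proof.
by move=> x0 y0; rewrite !damping_ge0E ?addr_ge0// mulrDr opprD expRD.
Qed.

Lemma damping_anti k (x y : R) : x <= y -> damping k y <= damping k x.
Proof.
move=> xy; rewrite /damping lerXn2r ?nnegrE ?expR_ge0// ler_expR lerN2.
by rewrite ge_max !le_max xy lexx orbT.
Qed.

Definition mean_damping (k : nat) (h : R) : R :=
  \int[P]_w damping k (increment X 0 h w).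

Let g k : R -> \bar R := EFin \o damping k.

Let mg k : measurable_fun setT (g k).
Proof. by apply/measurable_EFinP; exact: measurable_damping. Qed.

Let g0 k x : (0 <= g k x)%E. Proof. by rewrite lee_fin ltW// damping_gt0. Qed.

Let mgincr k a b : measurable_fun setT (fun w => g k (increment X a b w)).
Proof. exact: (measurableT_comp (mg k) (measurable_increment X a b)). Qed.

Lemma mean_dampingE k h :
  (\int[P]_w (damping k (increment X 0 h w))%:E = (mean_damping k h)%:E)%E.
Proof.
rewrite /mean_damping /Rintegral fineK// ge0_fin_numE; last first.
  by apply: integral_ge0 => w _; exact: g0.
apply: (@le_lt_trans _ _ (\int[P]_w (cst 1%:E w))%E).
  apply: ge0_le_integral => //.
  - by move=> w _; exact: g0.
  - exact: mgincr.
  - by move=> w _; rewrite lee_fin damping_le1.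
by rewrite integral_cst// [X in (_ * X)%E]probability_setT mule1 ltry.
Qed.

Lemma mean_dampingD k (a b : R) : 0 <= a -> 0 <= b ->
  mean_damping k (a + b) = mean_damping k a * mean_damping k b.
Proof.
move=> a0 b0; apply: EFin_inj.
have ab : a <= a + b by rewrite lerDl.
rewrite EFinM -!mean_dampingE.
have -> : (\int[P]_w (damping k (increment X 0 b w))%:E =
    \int[P]_w g k (increment X a (a + b) w))%E.
  by rewrite integral_increment_stationary.
rewrite -(integral_increment_independent subX (f := g k) (g := g k))//.
apply: ge0_ae_eq_integral => //.
- exact: mgincr.
- by apply: emeasurable_funM; exact: mgincr.
- by move=> w _; exact: g0.
- by move=> w _; rewrite mule_ge0.
have := subordinator_paths subX; apply: filterS => w pw _.
rewrite -EFinM -dampingD ?subr_ge0; [|exact: (path_le pw)..].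
by congr (damping _ _)%:E; rewrite /increment; ring.
Qed.

Lemma mean_damping_anti k (a b : R) : 0 <= a -> a <= b ->
  mean_damping k b <= mean_damping k a.
Proof.
move=> a0 ab; rewrite -lee_fin -!mean_dampingE.
apply: ae_ge0_le_integral => //.
- by move=> w _; exact: g0.
- exact: mgincr.
- by move=> w _; exact: g0.
- exact: mgincr.
have := subordinator_paths subX; apply: filterS => w pw _.
by rewrite lee_fin damping_anti// lerB// (path_le pw).
Qed.

Context (drift : R) (Pi : {measure set R -> \bar R}).
Hypothesis charX : has_characteristics X drift Pi.

Let levyPi : levy_measure Pi. Proof. by case: charX. Qed.

Local Notation pos := (`]0%R, +oo[%classic : set R).

Definition laplace_exp (k : nat) : R :=
  drift * k%:R + \int[Pi]_(x in pos) (1 - expR (- (k%:R * x))).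

Lemma integrable_laplace (k : nat) :
  Pi.-integrable pos (EFin \o (fun x => 1 - expR (- (k%:R * x)))).
Proof.
(* 1 - exp(-k x) is at most 1, which serves for [x >= 1], and at most k x, which serves for [x < 1];
   the sum of the two constants covers both. *)
apply: (levy_integrable levyPi (C := k%:R + 1)).
  apply: measurable_funB => //; apply: measurableT_comp => //.
  by apply: measurableT_comp => //; exact: measurable_funM.
move=> x x0.
have e1 : expR (- (k%:R * x)) <= 1.
  by rewrite -expR0 ler_expR oppr_le0 mulr_ge0// ltW.
have e2 : 1 - k%:R * x <= expR (- (k%:R * x)) := expR_ge1Dx _.
have e3 := expR_gt0 (- (k%:R * x)).
have k0 : 0 <= k%:R :> R by [].
rewrite ger0_norm ?subr_ge0//.
by case: (leP 1 x) => ?; nra.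
Qed.

Lemma laplace_exponentE (k : nat) :
  laplace_exponent drift Pi k%:R = (laplace_exp k)%:E.
Proof.
rewrite /laplace_exponent /laplace_exp EFinD fineK//.
exact: (integrable_fin_num _ (integrable_laplace k)).
Qed.

Lemma laplace_exp_ge0 k : 0 <= laplace_exp k.
Proof.
case: charX => d0 _ _; rewrite addr_ge0 ?mulr_ge0//.
apply: Rintegral_ge0 => x /=; rewrite in_itv/= andbT => x0.
by rewrite subr_ge0 -expR0 ler_expR oppr_le0 mulr_ge0// ltW.
Qed.

Lemma mean_damping_exp k (h : R) : 0 <= h ->
  mean_damping k h = expR (- (h * laplace_exp k)).
Proof.
apply: expR_of_multiplicative; [exact: mean_dampingD|exact: mean_damping_anti|].
apply: EFin_inj; rewrite -mean_dampingE.
case: charX => _ _ /(_ k%:R (ler0n _ _)).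
rewrite laplace_exponentE /= unlock => <-.
apply: ge0_ae_eq_integral => //.
- exact: mgincr.
- apply/measurable_EFinP; apply: measurableT_comp => //.
  by apply: measurableT_comp => //; exact: measurable_funM.
- by move=> w _; exact: g0.
have := subordinator_paths subX; apply: filterS => w pw _.
rewrite damping_ge0E /increment (path0 pw) subr0//.
by rewrite -(path0 pw) (path_le pw).
Qed.

(** From 1 - u <= exp(-u) <= 1 - u + u^2 with u = a / N, the error is at most a^2 / N. *)
Lemma cvg_mean_damping k (t : R) : 0 <= t ->
  n.+1%:R * (1 - mean_damping k (t / n.+1%:R)) @[n --> \oo] --> t * laplace_exp k.
Proof.
move=> t0; set a := t * laplace_exp k.
have a0 : 0 <= a by rewrite mulr_ge0// laplace_exp_ge0.
apply/cvgrPdist_lt => e e0; near=> n.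
rewrite mean_damping_exp ?divr_ge0// mulrAC -/a.
have N0 : 0 < n.+1%:R :> R by rewrite ltr0n.
have an : a ^+ 2 / n.+1%:R < e by near: n; exact: near_natSinv.
move: (n.+1%:R) N0 an => N N0 an.
pose u := a / N.
have u0 : 0 <= u by rewrite divr_ge0// ltW.
have aE : a = N * u by rewrite /u mulrC divfK ?gt_eqF.
rewrite -/u {1}aE -mulrBr.
have h1 : 1 - u <= expR (- u) := expR_ge1Dx _.
have h2 : expR (- u) * (1 + u) <= 1.
  have := expR_ge1Dx u; rewrite -(ler_pM2l (expR_gt0 (- u))).
  by rewrite -expRD addNr expR0.
have h3 := expR_gt0 (- u).
have h4 : expR (- u) <= 1 - u + u ^+ 2 by nra.
apply: le_lt_trans an; rewrite normrM (gtr0_norm N0).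
have -> : a ^+ 2 / N = N * u ^+ 2 by rewrite aE; field; rewrite gt_eqF.
rewrite ler_pM2l// ler_norml; apply/andP; split; lra.
Unshelve. all: by end_near. Qed.

End laplace.

(** * The method of moments *)

Section weighted_integral.
Context d (T : measurableType d) (R : realType) (m : {measure set T -> \bar R}).
Context (D : set T) (mD : measurable D) (u Y : T -> R).
Hypotheses (iu : m.-integrable D (EFin \o u)) (u0 : forall x, D x -> 0 <= u x).
Hypotheses (mY : measurable_fun D Y) (Y01 : forall x, D x -> 0 <= Y x <= 1).

(** It serves twice: under [P] with the weight 1 - Y and Y = exp(-X_h), and under [Pi] with the
    weight 1 - exp(-x) and Y = exp(-x). The weight is what makes bounded [f] integrable against the
    infinite measure [Pi]. *)
Definition weighted (f : R -> R) : R := \int[m]_(x in D) (u x * f (Y x)).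

Let mu_ : measurable_fun D u.
Proof. by apply/measurable_EFinP; exact: (measurable_int m iu). Qed.

Lemma weighted_integrable (f : R -> R) (M : R) :
  measurable_fun D (fun x => u x * f (Y x)) ->
  (forall y, 0 <= y <= 1 -> `|f y| <= M) ->
  m.-integrable D (EFin \o (fun x => u x * f (Y x))).
Proof.
move=> mf fM; have := integrableZl mD M iu.
apply: le_integrable => //; first exact/measurable_EFinP.
move=> x Dx /=; rewrite lee_fin !normrM mulrC.
by rewrite ler_wpM2r// (le_trans (fM _ (Y01 Dx)))// ler_norm.
Qed.

Lemma weighted_monomial_integrable (c : R) (k : nat) :
  m.-integrable D (EFin \o (fun x => u x * (c * Y x ^+ k))).
Proof.
apply: (weighted_integrable (f := fun y => c * y ^+ k) (M := `|c|)).
  by apply: measurable_funM => //; apply: measurable_funM => //; exact: measurable_funX.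
move=> y /andP[y0 y1]; rewrite normrM ler_piMr// ger0_norm ?exprn_ge0//.
by rewrite exprn_ile1.
Qed.

Lemma weighted_horner_integrable (p : {poly R}) :
  m.-integrable D (EFin \o (fun x => u x * p.[Y x])).
Proof.
apply: (weighted_integrable (f := horner p) (M := \sum_(i < size p) `|p`_i|)).
  apply: measurable_funM => //.
  have -> : (fun x => p.[Y x]) = (fun x => \sum_(i < size p) p`_i * Y x ^+ i).
    by apply/funext => x; rewrite horner_coef.
  by apply: measurable_sum => i; apply: measurable_funM => //; exact: measurable_funX.
move=> y /andP[y0 y1]; rewrite horner_coef (le_trans (ler_norm_sum _ _ _))//.
apply: ler_sum => i _; rewrite normrM ler_piMr// ger0_norm ?exprn_ge0//.
by rewrite exprn_ile1.
Qed.

Lemma weighted_horner (p : {poly R}) :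
  weighted (horner p) = \sum_(i < size p) p`_i * weighted (fun y => y ^+ i).
Proof.
rewrite /weighted.
under eq_Rintegral do rewrite horner_coef.
elim: (size p) => [|n ih].
  under eq_Rintegral do rewrite big_ord0 mulr0.
  by rewrite big_ord0 Rintegral_cst// mul0r.
under eq_Rintegral do rewrite big_ord_recr/= mulrDr.
rewrite big_ord_recr/= RintegralD//; last 2 first.
- apply: (weighted_integrable (f := fun y => \sum_(i < n) p`_i * y ^+ i)
      (M := \sum_(i < n) `|p`_i|)).
    apply: measurable_funM => //.
    by apply: measurable_sum => i; apply: measurable_funM => //; exact: measurable_funX.
  move=> y /andP[y0 y1]; rewrite (le_trans (ler_norm_sum _ _ _))//.
  apply: ler_sum => i _; rewrite normrM ler_piMr// ger0_norm ?exprn_ge0//.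
  by rewrite exprn_ile1.
- exact: weighted_monomial_integrable.
rewrite ih; congr (_ + _); under eq_Rintegral do rewrite mulrCA.
rewrite RintegralZl//; have := weighted_monomial_integrable 1 n.
by congr (integrable _ _ _); apply/funext => x /=; rewrite mul1r.
Qed.

Lemma weighted_close (f : R -> R) (p : {poly R}) (e : R) :
  m.-integrable D (EFin \o (fun x => u x * f (Y x))) ->
  (forall y, 0 <= y <= 1 -> `|f y - p.[y]| <= e) ->
  `|weighted f - weighted (horner p)| <= e * weighted (fun y => y ^+ 0).
Proof.
move=> if_ fp; rewrite /weighted.
under [X in e * X]eq_Rintegral do rewrite expr0 mulr1.
rewrite -RintegralB//; last exact: weighted_horner_integrable.
have ifp : m.-integrable D (EFin \o (fun x => u x * f (Y x) - u x * p.[Y x])).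
  by have := integrableB mD if_ (weighted_horner_integrable p).
apply: (le_trans (le_normr_Rintegral mD ifp)).
rewrite -RintegralZl//; apply: le_Rintegral => //.
- exact: integrable_norm.
- by have := integrableZl mD e iu.
move=> x Dx; rewrite -mulrBr normrM mulrC (ger0_norm (u0 Dx)).
by rewrite ler_wpM2r ?u0// fp// Y01.
Qed.

End weighted_integral.

(* A method of moments: convergence on the monomials extends to [f] by
   uniform approximation, the total masses [L n (fun y => y ^+ 0)] being
   bounded. *)
Lemma cvg_of_moments (R : realType) (L : nat -> (R -> R) -> R) (L' : (R -> R) -> R)
    (f : R -> R) :
  {within `[0, 1], continuous f} ->
  (forall k, L n (fun y => y ^+ k) @[n --> \oo] --> L' (fun y => y ^+ k)) ->
  (forall n (p : {poly R}), L n (horner p) =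
    \sum_(i < size p) p`_i * L n (fun y => y ^+ i)) ->
  (forall p : {poly R}, L' (horner p) =
    \sum_(i < size p) p`_i * L' (fun y => y ^+ i)) ->
  (forall n (p : {poly R}) e, (forall y, 0 <= y <= 1 -> `|f y - p.[y]| <= e) ->
    `|L n f - L n (horner p)| <= e * L n (fun y => y ^+ 0)) ->
  (forall (p : {poly R}) e, (forall y, 0 <= y <= 1 -> `|f y - p.[y]| <= e) ->
    `|L' f - L' (horner p)| <= e * L' (fun y => y ^+ 0)) ->
  L n f @[n --> \oo] --> L' f.
Proof.
move=> cf Lk Lp Lp' Lf Lf'; apply/cvgrPdist_lt => e e0.
(* [M] bounds the total mass of [L'] and, for large [n], that of [L n], so an approximation of [f]
   within [e / 3 / M] costs at most [e / 3] on each side. *)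
pose M := `|L' (fun y => y ^+ 0)| + 1.
have M0 : 0 < M by rewrite ltr_wpDl.
have eM : 0 < e / 3 / M by rewrite !divr_gt0.
have [p fp] := weierstrass cf eM.
have LM : \forall n \near \oo, L n (fun y => y ^+ 0) <= M.
  have /cvgrPdist_lt/(_ 1 ltr01) := Lk 0%N; apply: filterS => n.
  rewrite distrC => /(le_lt_trans (ler_norm _)) h.
  have := ler_norm (L' (fun y => y ^+ 0)); rewrite /M; lra.
have cp : L n (horner p) @[n --> \oo] --> L' (horner p).
  rewrite Lp'; under eq_fun do rewrite Lp.
  apply: cvg_big => [|i _]; first exact: add_continuous.
  by apply: cvgM; [exact: cvg_cst|exact: Lk].
near=> n.
have h1 : `|L' f - L' (horner p)| <= e / 3.
  rewrite (le_trans (Lf' _ _ fp))// -[leRHS](divfK (lt0r_neq0 M0)).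
  rewrite ler_wpM2l// ?(ltW eM)// (le_trans (ler_norm _))//.
  by rewrite /M lerDl.
have h2 : `|L n f - L n (horner p)| <= e / 3.
  rewrite (le_trans (Lf _ _ _ fp))// -[leRHS](divfK (lt0r_neq0 M0)).
  by rewrite ler_wpM2l// ?(ltW eM)//; near: n.
have h3 : `|L' (horner p) - L n (horner p)| < e / 3.
  by near: n; move/cvgrPdist_lt : cp; apply; rewrite divr_gt0.
have -> : L' f - L n f = (L' f - L' (horner p)) +
   (L' (horner p) - L n (horner p)) - (L n f - L n (horner p)) by ring.
rewrite (le_lt_trans (ler_normB _ _))//.
have := ler_normD (L' f - L' (horner p)) (L' (horner p) - L n (horner p)).
move=> /le_lt_trans-/(_ (e / 3 + e / 3)) h.
have : `|L' f - L' (horner p) + (L' (horner p) - L n (horner p))| < e / 3 + e / 3.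
  by apply: h; exact: ler_ltD.
move: h2; set A := `|_|; set B := `|_| => ? ?; lra.
Unshelve. all: by end_near. Qed.

(* [min x delta] as a function of [y = expR (- x)], divided by [1 - y]; it
   extends continuously to [y = 0] and [y = 1]. *)
Definition trunc_shape (R : realType) (delta y : R) : R :=
  if y < 1 then - ln (Num.max y (expR (- delta))) / (1 - y) else 1.

Lemma trunc_shape_expR (R : realType) (delta x : R) : 0 < x -> 0 < delta ->
  (1 - expR (- x)) * trunc_shape delta (expR (- x)) = Num.min x delta.
Proof.
move=> x0 d0; have x1 : expR (- x) < 1 by rewrite -expR0 ltr_expR oppr_lt0.
rewrite /trunc_shape x1 mulrC divfK ?gt_eqF ?subr_gt0//.
case: (leP x delta) => xd.
  by rewrite max_l ?ler_expR ?lerN2// expRK opprK.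
by rewrite max_r ?ler_expR ?lerN2 ?(ltW xd)// expRK opprK.
Qed.

(** With y = exp(-u), the inequalities 1 - u <= exp(-u) and 1 + u <= exp(u) place u / (1 - y)
    between 1 and 1 / y. *)
Lemma trunc_shape_bound (R : realType) (delta y : R) :
  expR (- delta) < y -> y < 1 -> `|1 - trunc_shape delta y| <= y^-1 - 1.
Proof.
move=> dy y1; have y0 : 0 < y := lt_trans (expR_gt0 _) dy.
rewrite /trunc_shape y1 (max_l (ltW dy)).
have [u yE] : exists u, y = expR (- u) by exists (- ln y); rewrite opprK lnK.
have u0 : 0 < u by move: y1; rewrite yE -expR0 ltr_expR oppr_lt0.
have h1 : 1 - u <= y by rewrite yE; exact: expR_ge1Dx.
have h2 : 1 + u <= y^-1 by rewrite yE expRN invrK; exact: expR_ge1Dx.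
have -> : - ln y = u by rewrite yE expRK opprK.
have yy : y * y^-1 = 1 by rewrite mulfV// gt_eqF.
have hu : 1 <= u / (1 - y) by rewrite ler_pdivlMr ?subr_gt0//; lra.
have hv : u / (1 - y) <= y^-1.
  rewrite ler_pdivrMr ?subr_gt0//; nra.
rewrite ler_norml; apply/andP; split; lra.
Qed.

Lemma continuous_trunc_shape (R : realType) (delta : R) : 0 < delta ->
  {within `[0, 1], continuous (trunc_shape delta)}.
Proof.
move=> d0; apply/subspace_continuousP => y /=; rewrite /from_subspace in_itv/= => /andP[y0].
rewrite le_eqVlt => /predU1P[->|y1].
  have ts1 : trunc_shape delta 1 = 1 by rewrite /trunc_shape ltxx.
  apply/cvgrPdist_le => e e0.
  have e1 : 0 < 1 + e by lra.
  have ed1 : expR (- delta) < 1 by rewrite -expR0 ltr_expR oppr_lt0.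
  have ee1 : (1 + e)^-1 < 1 by rewrite invf_lt1// ltrDl.
  rewrite near_withinE; near=> z => /=; rewrite in_itv/= => /andP[z0].
  rewrite le_eqVlt => /predU1P[->|z1].
    by rewrite subrr normr0 ltW.
  have dz : expR (- delta) < z by near: z; exact: lt_nbhsr.
  (* This is the condition under which the bound [z^-1 - 1] is at most [e]. *)
  have ez : (1 + e)^-1 < z by near: z; exact: lt_nbhsr.
  rewrite ts1 (le_trans (trunc_shape_bound dz z1))//.
  rewrite lerBlDr addrC -[leRHS]invrK lef_pV2 ?posrE ?invr_gt0 ?ltW//.
  exact: lt_trans (expR_gt0 _) dz.
apply: cvg_within_filter.
have tsy : trunc_shape delta y = - ln (Num.max y (expR (- delta))) / (1 - y).
  by rewrite /trunc_shape y1.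
rewrite tsy.
apply: (@cvg_trans _
  (- ln (Num.max z (expR (- delta))) / (1 - z) @[z --> y])).
  apply: near_eq_cvg; near=> z; rewrite /trunc_shape.
  by rewrite [z < 1](_ : _ = true)//; near: z; exact: lt_nbhsl.
have c1 : - ln (Num.max z (expR (- delta))) @[z --> y] -->
    - ln (Num.max y (expR (- delta))).
  apply: cvgN; apply: continuous_cvg.
    by apply: continuous_ln; rewrite lt_max expR_gt0 orbT.
  apply: (@continuous_max R R id (cst (expR (- delta))) y).
    exact: cvg_id.
  exact: cvg_cst.
have c2 : (1 - z)^-1 @[z --> y] --> (1 - y)^-1.
  apply: cvgV; first by rewrite subr_eq0 eq_sym lt_eqF.
  by apply: cvgB; [exact: cvg_cst|exact: cvg_id].
exact: cvgM c1 c2.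
Unshelve. all: by end_near. Qed.

(** * Limit of the means of the truncated sums *)

Section mean_trunc_limit.
Context (R : realType) d (T : measurableType d) (P : probability T R).
Context (X : R -> {RV P >-> R}) (subX : subordinator X).
Context (drift : R) (Pi : {measure set R -> \bar R}).
Hypothesis charX : has_characteristics X drift Pi.

Local Notation pos := (`]0%R, +oo[%classic : set R).

Let levyPi : levy_measure Pi. Proof. by case: charX. Qed.

Let mpos : measurable pos. Proof. exact: measurable_itv. Qed.

Let Y (h : R) (w : T) : R := damping 1 (increment X 0 h w).

Let mY (h : R) : measurable_fun setT (Y h).
Proof.
by apply: measurableT_comp; [exact: measurable_damping|exact: measurable_increment].
Qed.

Let Y01 (h : R) w : 0 <= Y h w <= 1.
Proof. by rewrite damping_le1 ltW// damping_gt0. Qed.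

Let YX (h : R) w k : Y h w ^+ k = damping k (increment X 0 h w).
Proof. by rewrite /Y /damping expr1. Qed.

Let bounded_int (f : T -> R) : measurable_fun setT f ->
  (forall w, 0 <= f w <= 1) -> P.-integrable setT (EFin \o f).
Proof.
move=> mf f01; apply: measurable_bounded_integrable => //.
  by rewrite (le_lt_trans (probability_le1 P measurableT))// ltry.
exists 1; split => // M M1 w _ /=; have /andP[? ?] := f01 w.
by rewrite ger0_norm// (le_trans _ (ltW M1)).
Qed.

Let u (h : R) w := 1 - Y h w.

Let mu_ (h : R) : measurable_fun setT (u h).
Proof. exact: measurable_funB. Qed.

Let u01 (h : R) w : 0 <= u h w <= 1.
Proof. by rewrite /u; have /andP[? ?] := Y01 h w; apply/andP; split; lra. Qed.

Let iu (h : R) : P.-integrable setT (EFin \o u h).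
Proof. exact: bounded_int. Qed.

Let iYX (h : R) k : P.-integrable setT (EFin \o (fun w => Y h w ^+ k)).
Proof.
apply: bounded_int; first exact: measurable_funX.
by move=> w; have /andP[? ?] := Y01 h w; rewrite exprn_ge0// exprn_ile1.
Qed.

Let weightedX (h : R) k : weighted P setT (u h) (Y h) (fun y => y ^+ k) =
  mean_damping X k h - mean_damping X k.+1 h.
Proof.
rewrite /weighted /mean_damping.
under [X in _ = X - _]eq_Rintegral do rewrite -YX.
under [X in _ = _ - X]eq_Rintegral do rewrite -YX.
rewrite -RintegralB//; try exact: iYX.
by apply: eq_Rintegral => w _; rewrite /u exprS; ring.
Qed.

Let uf (h delta : R) w : 0 < delta ->
  u h w * trunc_shape delta (Y h w) = trunc delta (increment X 0 h w).
Proof.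
move=> d0; rewrite /u /Y /damping expr1 /trunc.
have [x0|x0] := leP (increment X 0 h w) 0.
  rewrite oppr0 expR0 subrr mul0r.
  by rewrite max_r// ge_min x0.
rewrite trunc_shape_expR// max_l// le_min; apply/andP; split; exact: ltW.
Qed.

Let iuf (h delta : R) : 0 < delta ->
  P.-integrable setT (EFin \o (fun w => u h w * trunc_shape delta (Y h w))).
Proof.
move=> d0; rewrite (_ : (fun w => _) = trunc delta \o increment X 0 h).
  apply: measurable_bounded_integrable => //.
  - by rewrite (le_lt_trans (probability_le1 P measurableT))// ltry.
  - exact: (measurableT_comp (measurable_trunc delta) (measurable_increment X 0 h)).
  - exists delta; split => [|M Md w _ /=]; first exact: num_real.
    by rewrite ger0_norm ?trunc_ge0// (le_trans (trunc_le _ (ltW d0)))// ltW.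
by apply/funext => w; rewrite uf.
Qed.

Let Lu (x : R) := 1 - expR (- x).
Let LY (x : R) := expR (- x).

Let mLY : measurable_fun pos LY.
Proof. by apply: measurableT_comp => //; exact: measurableT_comp. Qed.

Let LY01 x : pos x -> 0 <= LY x <= 1.
Proof.
rewrite /= in_itv/= andbT => x0.
by rewrite expR_ge0 -expR0 ler_expR oppr_le0 ltW.
Qed.

Let Lu0 x : pos x -> 0 <= Lu x.
Proof. by move=> /LY01/andP[_]; rewrite /Lu subr_ge0. Qed.

Let iLu : Pi.-integrable pos (EFin \o Lu).
Proof.
have := integrable_laplace charX 1.
by congr (integrable _ _ _); apply/funext => x /=; rewrite mul1r.
Qed.

Let iLuf (delta : R) : 0 < delta ->
  Pi.-integrable pos (EFin \o (fun x => Lu x * trunc_shape delta (LY x))).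
Proof.
move=> d0; have := levy_integrable_min levyPi (ltW d0).
apply: eq_integrable => // x /set_mem /=; rewrite in_itv/= andbT => x0.
by rewrite /Lu /LY trunc_shape_expR.
Qed.

(** In the variable y = exp(-x), the limit measure has an atom of mass [drift] at y = 1, that is at
    x = 0, beside the image of (1 - exp(-x)) Pi(dx). Its moments are the increments of the Laplace
    exponent. *)
Let LweightedX k : drift + weighted Pi pos Lu LY (fun y => y ^+ k) =
  laplace_exp drift Pi k.+1 - laplace_exp drift Pi k.
Proof.
rewrite /laplace_exp -natr1 mulrDr mulr1 [RHS](_ : _ = drift +
  (\int[Pi]_(x in pos) (1 - expR (- (k.+1%:R * x))) -
   \int[Pi]_(x in pos) (1 - expR (- (k%:R * x))))); last first.
  by rewrite natr1; ring.
congr (_ + _); rewrite -RintegralB//; try exact: (integrable_laplace charX).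
apply: eq_Rintegral => x _; rewrite /Lu /LY -expRM_natl -natr1.
rewrite (_ : - ((k%:R + 1) * x) = k%:R * - x + - x); last by ring.
by rewrite expRD mulrN; ring.
Qed.

(** Dividing the truncation by 1 - y makes it the continuous test function [trunc_shape delta]. Its
    value 1 at y = 1 lets the atom contribute exactly [drift]. *)
Lemma cvg_mean_trunc (t delta : R) : 0 < t -> 0 < delta ->
  n.+1%:R * mean_trunc X (t / n.+1%:R) delta @[n --> \oo] -->
  t * (drift + levy_tail_mean Pi delta).
Proof.
move=> t0 d0.
pose f := trunc_shape delta.
pose L n (g : R -> R) :=
  n.+1%:R * weighted P setT (u (t / n.+1%:R)) (Y (t / n.+1%:R)) g.
pose L' (g : R -> R) := t * (drift * g 1 + weighted Pi pos Lu LY g).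
have Lf n : L n f = n.+1%:R * mean_trunc X (t / n.+1%:R) delta.
  by congr (_ * _); apply: eq_Rintegral => w _; rewrite uf.
have L'f : L' f = t * (drift + levy_tail_mean Pi delta).
  rewrite /L' /f [trunc_shape delta 1](_ : _ = 1) ?mulr1; last first.
    by rewrite /trunc_shape ltxx.
  congr (_ * (_ + _)); apply: eq_Rintegral => x /set_mem /=.
  by rewrite in_itv/= andbT => x0; rewrite trunc_shape_expR.
rewrite -L'f; under eq_fun do rewrite -Lf.
apply: cvg_of_moments; first exact: continuous_trunc_shape.
- move=> k; rewrite /L /L' expr1n mulr1 LweightedX mulrBr.
  rewrite (_ : (fun n => _) = (fun n =>
      n.+1%:R * (1 - mean_damping X k.+1 (t / n.+1%:R)) -
      n.+1%:R * (1 - mean_damping X k (t / n.+1%:R)))); last first.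
    by apply/funext => n; rewrite weightedX; ring.
  by apply: cvgB; apply: (cvg_mean_damping subX charX); exact: ltW.
- move=> n p; rewrite /L weighted_horner// mulr_sumr.
  by apply: eq_bigr => i _; rewrite mulrCA.
- move=> p; rewrite /L' weighted_horner// horner_coef mulr_sumr -big_split/=.
  rewrite mulr_sumr; apply: eq_bigr => i _; ring.
- move=> n p e fp; rewrite /L -mulrBr normrM ger0_norm// mulrCA.
  rewrite ler_pM2l ?ltr0n//; apply: weighted_close => //; last exact: iuf.
  by move=> w _; have /andP[] := u01 (t / n.+1%:R) w.
- move=> p e fp; rewrite /L' expr0 mulr1 -mulrBr normrM (gtr0_norm t0) mulrCA.
  rewrite ler_pM2l// mulrDr.
  have -> : drift * f 1 + weighted Pi pos Lu LY f -
      (drift * p.[1] + weighted Pi pos Lu LY (horner p)) =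
    drift * (f 1 - p.[1]) +
      (weighted Pi pos Lu LY f - weighted Pi pos Lu LY (horner p)) by ring.
  rewrite (le_trans (ler_normD _ _))// lerD//.
    case: charX => drift0 _ _; rewrite normrM (ger0_norm drift0) mulrC.
    by rewrite ler_wpM2r// fp// ler01 lexx.
  by apply: weighted_close => //; exact: iLuf.
Qed.

End mean_trunc_limit.

(** * From the subsequence to the limit *)

(** Both S(x) / x and a(x) / x are nonincreasing, so between two terms of the subsequence their
    quotient is squeezed by quotients at those terms, up to ratios of nearby [q] that tend to 1. *)
Lemma cvg_ratio_of_subsequence (R : realType) (S a : R -> R) (t : R)
    (dl q : nat -> R) :
  (forall x, 0 < x -> 0 <= S x) -> (forall x, 0 < x -> 0 < a x) ->
  (forall x y, 0 < x -> x <= y -> S y / y <= S x / x) ->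
  (forall x y, 0 < x -> x <= y -> a y / y <= a x / x) ->
  (forall k, 0 < dl k) -> (forall k, a (dl k) / dl k = q k) ->
  (forall k, q k < q k.+1) -> (forall x, exists k, x <= q k) ->
  S (dl k) / a (dl k) @[k --> \oo] --> t ->
  q k / q k.+1 @[k --> \oo] --> (1 : R) ->
  S x / a x @[x --> 0^'+] --> t.
Proof.
move=> S0 a0 Santi aanti dl0 aq qlt qoo cS cq.
have q0 k : 0 < q k by rewrite -aq divr_gt0// a0.
have Sq k : S (dl k) / dl k = S (dl k) / a (dl k) * q k.
  by rewrite -aq; field; rewrite !gt_eqF// a0.
have Sx0 k : 0 <= S (dl k) / dl k by rewrite divr_ge0 ?S0// ltW.
(* [l k] and [u k] bound [S x / a x] from below and above whenever [q k < a x / x <= q k.+1]. *)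
pose l k := S (dl k) / dl k / q k.+1.
pose u k := S (dl k.+2) / dl k.+2 / q k.
have cl : l k @[k --> \oo] --> t.
  rewrite (_ : l = (fun k => S (dl k) / a (dl k) * (q k / q k.+1))).
    by rewrite -[X in _ --> X]mulr1; exact: (cvgM cS cq).
  by apply/funext => k; rewrite /l Sq mulrA.
have cu : u k @[k --> \oo] --> t.
  have cS2 : S (dl k.+2) / a (dl k.+2) @[k --> \oo] --> t.
    by move: cS; rewrite -(cvg_shiftS _) -(cvg_shiftS _).
  have cq1 : q k.+1 / q k.+2 @[k --> \oo] --> (1 : R).
    by move: cq; rewrite -(cvg_shiftS _).
  have cq2 : q k / q k.+1 * (q k.+1 / q k.+2) @[k --> \oo] --> (1 : R).
    by rewrite -[X in _ --> X]mulr1; exact: (cvgM cq cq1).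
  have cq3 : (q k / q k.+1 * (q k.+1 / q k.+2))^-1 @[k --> \oo] --> (1 : R).
    by rewrite -[X in _ --> X]invr1; exact: cvgV (oner_neq0 R) cq2.
  rewrite (_ : u = (fun k => S (dl k.+2) / a (dl k.+2) *
      (q k / q k.+1 * (q k.+1 / q k.+2))^-1)).
    by rewrite -[X in _ --> X]mulr1; exact: (cvgM cS2 cq3).
  apply/funext => k; rewrite /u Sq /=; field.
  by rewrite !gt_eqF// a0.
apply/cvgrPdist_le => e e0.
have [N _ hN] : \forall k \near \oo, `|t - l k| <= e /\ `|t - u k| <= e.
  by near=> k; split; near: k; [move/cvgrPdist_le : cl|move/cvgrPdist_le : cu]; apply.
have q_le i j : (i <= j)%N -> q i <= q j.
  by elim: j => [|j ih]; [rewrite leqn0 => /eqP ->|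
    rewrite leq_eqVlt => /predU1P[->//|/ih/le_trans]; apply; exact: ltW].
near=> x.
have x0 : 0 < x by near: x; exact: nbhs_right_gt.
(* Below [dl N.+1] the ratio [a x / x] exceeds [q N], which pushes the index chosen next beyond
   [N]. *)
have xN : x <= dl N.+1 by near: x; exact: nbhs_right_le.
pose r := a x / x.
have r0 : 0 < r by rewrite divr_gt0// a0.
have Nr : q N < r by rewrite (lt_le_trans (qlt N))// -aq; exact: aanti.
have [i ri imin] := ex_minnP (qoo r).
have Ni : (N < i)%N.
  by rewrite ltnNge; apply/negP => /q_le /(le_trans ri); rewrite leNgt Nr.
case: i ri imin Ni => // k rk kmin; rewrite ltnS => Nk.
have kr : q k < r.
  by rewrite ltNge; apply/negP => /kmin; rewrite ltnn.
have xk : x <= dl k.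
  rewrite leNgt; apply/negP => /ltW/(aanti _ _ (dl0 k)); rewrite aq leNgt.
  by rewrite kr.
(* The index is [k.+2] because [r] may equal [q k.+1], and a ratio that is merely nonincreasing
   would then not order [x] and [dl k.+1]. *)
have kx : dl k.+2 <= x.
  rewrite leNgt; apply/negP => /ltW/(aanti _ _ x0); rewrite aq leNgt.
  by rewrite (le_lt_trans rk).
have -> : S x / a x = S x / x / r by rewrite /r; field; rewrite !gt_eqF// a0.
have [/= lk uk] := hN k Nk.
have lS : l k <= S x / x / r.
  apply: (@le_trans _ _ (S (dl k) / dl k / r)).
    by rewrite /l ler_wpM2l ?Sx0// lef_pV2 ?posrE.
  by rewrite ler_wpM2r ?invr_ge0 ?(ltW r0)// Santi.
have uS : S x / x / r <= u k.
  apply: (@le_trans _ _ (S (dl k.+2) / dl k.+2 / r)).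
    by rewrite ler_wpM2r ?invr_ge0 ?(ltW r0)// Santi.
  by rewrite /u ler_wpM2l ?Sx0// lef_pV2 ?posrE// ltW.
move: lk uk; rewrite !ler_norml => /andP[? ?] /andP[? ?].
by apply/andP; split; lra.
Unshelve. all: by end_near. Qed.

(** * The scale delta mu(delta) and the choice of the subsequence *)

Section levy_scale.
Context (R : realType) (Pi : {measure set R -> \bar R}) (drift : R).
Hypotheses (levyPi : levy_measure Pi) (drift0 : 0 <= drift).
Hypothesis Pi_infinite : Pi `]0, +oo[%classic = +oo%E.

(** For delta > 0 this is delta mu(delta) as a real number, by [muE]. *)
Definition drift_tail (delta : R) : R := drift + levy_tail_mean Pi delta.

Local Notation I := (levy_tail_mean Pi).

Lemma le_drift_tail (x y : R) : 0 <= x -> x <= y -> drift_tail x <= drift_tail y.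
Proof. by move=> x0 xy; rewrite lerD2l (le_levy_tail_mean levyPi). Qed.

Lemma drift_tail_concave (x y : R) : 0 <= x -> x <= y ->
  x * drift_tail y <= y * drift_tail x.
Proof.
move=> x0 xy; rewrite !mulrDr lerD//; last exact: levy_tail_mean_concave.
by rewrite ler_wpM2r.
Qed.

Lemma drift_tail_anti (x y : R) : 0 < x -> x <= y ->
  drift_tail y / y <= drift_tail x / x.
Proof.
move=> x0 xy; have y0 := lt_le_trans x0 xy.
rewrite ler_pdivrMr// mulrAC ler_pdivlMr// mulrC (mulrC _ y).
by apply: drift_tail_concave => //; exact: ltW.
Qed.

(** The infinite mass gives one point where I is positive; concavity carries this to smaller
    arguments and monotonicity to larger ones. *)
Lemma drift_tail_gt0 (x : R) : 0 < x -> 0 < drift_tail x.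
Proof.
move=> x0; rewrite ltr_wpDl//.
have [y y0] := levy_tail_mean_unbounded levyPi 1 Pi_infinite; rewrite mul1r => yI.
have [xy|/ltW yx] := leP x y.
  have := levy_tail_mean_concave levyPi (ltW x0) xy.
  have xI : 0 < x * I y by rewrite mulr_gt0// (lt_le_trans y0).
  by move=> /(lt_le_trans xI); rewrite pmulr_rgt0.
by apply: (lt_le_trans y0); apply: (le_trans yI); exact: le_levy_tail_mean (ltW y0) yx.
Qed.

(** The equation says mu(x) = c. As mu(1) <= c and mu is at least [c] at some [y], the intermediate
    value theorem applies when [y < 1]; otherwise monotonicity forces mu(1) = c. *)
Lemma drift_tail_ivt (c : R) : drift_tail 1 <= c ->
  exists2 x, 0 < x <= 1 & drift_tail x = c * x.
Proof.
move=> c1; have [y y0 yc] := levy_tail_mean_unbounded levyPi c Pi_infinite.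
have {}yc : c * y <= drift_tail y by rewrite (le_trans yc)// lerDr.
have [y1|/ltW y1] := leP 1 y.
  exists 1; first by rewrite ltr01 lexx.
  have := drift_tail_anti ltr01 y1; rewrite divr1 ler_pdivrMr// => h.
  by apply/eqP; rewrite mulr1 eq_le c1 -(ler_pM2r y0) (le_trans yc).
pose f x := drift_tail x - c * x.
have cf : {within `[y, 1], continuous f}.
  apply/subspace_continuousP => x /=; rewrite in_itv/= => /andP[yx x1].
  (* Concavity bounds the slope beyond [u] by [drift_tail u / u], hence a Lipschitz constant on
     [[y, 1]]. *)
  have lip u v : y <= u -> u <= v -> v <= 1 ->
      drift_tail v - drift_tail u <= (v - u) * (drift_tail 1 / y).
    move=> yu uv v1; have u0 := lt_le_trans y0 yu.
    have h := drift_tail_concave (ltW u0) uv.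
    have h1 := le_drift_tail (ltW u0) (le_trans uv v1).
    have h2 : drift_tail v - drift_tail u <= (v - u) * (drift_tail u / u).
      by rewrite mulrA ler_pdivlMr//; lra.
    apply: (le_trans h2); rewrite ler_wpM2l ?subr_ge0//.
    apply: ler_pM => //.
    - exact/ltW/drift_tail_gt0.
    - by rewrite invr_ge0 ltW.
    - by rewrite lef_pV2 ?posrE.
  pose C := drift_tail 1 / y.
  have C0 : 0 < C by rewrite divr_gt0// drift_tail_gt0.
  have absx z : y <= z <= 1 -> `|drift_tail x - drift_tail z| <= `|x - z| * C.
    move=> /andP[yz z1]; have [xz|/ltW zx] := leP x z.
      rewrite distrC (distrC x) !ger0_norm ?subr_ge0 ?lip//.
      by rewrite le_drift_tail// ltW// (lt_le_trans y0).
    rewrite !ger0_norm ?subr_ge0 ?lip//.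
    by rewrite le_drift_tail// ltW// (lt_le_trans y0).
  apply: cvgB; last first.
    by apply: cvg_within_filter; apply: cvgM; [exact: cvg_cst|exact: cvg_id].
  apply/cvgrPdist_lt => e e0; rewrite near_withinE.
  have : \forall z \near x, `|x - z| < e / C.
    by apply: nbhsx_ballx; rewrite divr_gt0.
  apply: filterS => z xz; rewrite /= in_itv/= => yz1.
  by rewrite (le_lt_trans (absx z yz1))// -ltr_pdivlMr.
have fy1 : Num.min (f y) (f 1) <= 0 <= Num.max (f y) (f 1).
  apply/andP; split.
    by rewrite ge_min; apply/orP; right; rewrite /f mulr1 subr_le0.
  by rewrite le_max; apply/orP; left; rewrite /f subr_ge0.
have [x] := IVT y1 cf fy1; rewrite in_itv/= => /andP[yx x1] /eqP.
rewrite /f subr_eq0 => /eqP fx; exists x => //.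
by rewrite x1 (lt_le_trans y0).
Qed.

(** The shift [K] lifts all prescribed values of mu to at least mu(1), the range where
    [drift_tail_ivt] gives a solution. *)
Lemma drift_tail_scale : exists K (dl : nat -> R), (0 < K)%N /\ forall k,
  0 < dl k <= 1 /\
  drift_tail (dl k) = (k + K)%:R * (k + K).+1%:R * dl k.
Proof.
near \oo => K0.
pose K := K0.+1.
have aK k : drift_tail 1 <= (k + K)%:R * (k + K).+1%:R.
  have h : drift_tail 1 <= K0%:R by near: K0; exact: nbhs_infty_ger.
  rewrite (le_trans h)// -natrM ler_nat /K.
  by rewrite (leq_trans (leqnSn _))// (leq_trans (leq_addl k _))// leq_pmulr.
have ex k : exists x, 0 < x <= 1 /\
    drift_tail x = (k + K)%:R * (k + K).+1%:R * x.
  by have [x x01 xE] := drift_tail_ivt (aK k); exists x.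
have /choice[dl hdl] := ex.
by exists K, dl.
Unshelve. all: by end_near. Qed.

Lemma cvg_drift_tail0 : drift_tail x @[x --> 0^'+] --> drift.
Proof.
rewrite -[X in _ --> X]addr0; apply: cvgD; first exact: cvg_cst.
exact: cvg_levy_tail_mean0.
Qed.

End levy_scale.

Lemma cvg0_of_nneseries_fin (R : realType) (v : nat -> R) :
  (forall k, 0 <= v k) -> (\sum_(k <oo) (v k)%:E \is a fin_num)%E ->
  v k @[k --> \oo] --> 0.
Proof.
move=> v0 vfin; apply: cvg_series_cvg_0; apply: nondecreasing_is_cvgn.
  by apply/nondecreasing_seqP => n; rewrite !seriesEnat/= big_nat_recr//= lerDl.
exists (fine (\sum_(k <oo) (v k)%:E)%E) => _ [n _ <-].
rewrite -lee_fin fineK// seriesEnat/= -sumEFin.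
by apply: nneseries_lim_ge => k _ _; rewrite lee_fin.
Qed.

(** * Almost sure convergence *)

Section almost_sure_limit.
Context (R : realType) d (T : measurableType d) (P : probability T R).
Context (X : R -> {RV P >-> R}) (subX : subordinator X).
Context (drift : R) (Pi : {measure set R -> \bar R}).
Hypothesis charX : has_characteristics X drift Pi.
Hypothesis Pi_infinite : Pi `]0, +oo[%classic = +oo%E.
Context (t : R) (t0 : 0 < t).

Local Notation a := (drift_tail Pi drift).

Let levyPi : levy_measure Pi. Proof. by case: charX. Qed.
Let drift0 : 0 <= drift. Proof. by case: charX. Qed.

Definition truncated_limit (delta : R) (w : T) : R :=
  continuous_part (fun s => X s w) t + jump_sum (fun s => X s w) delta t.

Let M (delta : R) n : R := n.+1%:R * mean_trunc X (t / n.+1%:R) delta.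

(** A lower limit of measurable functions is measurable, whereas [truncated_limit] is built from
    sums over uncountably many times. The two are related on subordinator paths by
    [truncated_deviationE]. *)
Definition truncated_deviation (delta : R) (w : T) : \bar R :=
  limn_einf (fun n => ((truncated_sum X t delta n w - M delta n) ^+ 2)%:E).

Let mdev (delta : R) n : measurable_fun setT
  (fun w => ((truncated_sum X t delta n w - M delta n) ^+ 2)%:E).
Proof.
apply/measurable_EFinP/measurable_funX; apply: measurable_funB => //.
exact: measurable_truncated_sum.
Qed.

Lemma measurable_truncated_deviation (delta : R) :
  measurable_fun setT (truncated_deviation delta).
Proof.
apply: measurableT_comp => //; apply: measurable_fun_limn_esup => n.
by apply: measurableT_comp => //; exact: mdev.
Qed.

Lemma truncated_deviation_ge0 (delta : R) w :
  (0 <= truncated_deviation delta w)%E.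
Proof.
rewrite /truncated_deviation limn_einf_lim; apply: lime_ge.
  exact: is_cvg_einfs.
near=> n; apply: le_ereal_inf_tmp => _ [k _ <-].
by rewrite lee_fin sqr_ge0.
Unshelve. all: by end_near. Qed.

Lemma integral_truncated_deviation (delta : R) : 0 < delta ->
  (\int[P]_w truncated_deviation delta w <= (delta * (t * a delta))%:E)%E.
Proof.
move=> d0; apply: (@le_trans _ _ (limn_einf (fun n =>
    \int[P]_w ((truncated_sum X t delta n w - M delta n) ^+ 2)%:E)%E)).
  by apply: fatou => // n w _; rewrite lee_fin sqr_ge0.
have cM : (delta * M delta n)%:E @[n --> \oo] --> (delta * (t * a delta))%:E.
  apply: cvg_EFin; first by near=> n.
  by apply: cvgM; [exact: cvg_cst|exact: (cvg_mean_trunc subX charX)].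
rewrite -(cvg_lim _ cM)// -is_cvg_limn_einfE; last exact: (cvgP _ cM).
rewrite !limn_einf_lim; apply: lee_lim; [exact: is_cvg_einfs..|].
near=> n; apply: le_ereal_inf_tmp => _ [k /= nk <-].
apply: (@le_trans _ _ (\int[P]_w ((truncated_sum X t delta k w - M delta k) ^+ 2)%:E)%E).
  by apply: ereal_inf_lbound; exists k.
exact: variance_truncated_sum.
Unshelve. all: by end_near. Qed.

Lemma truncated_deviationE (delta : R) w : 0 < delta ->
  subordinator_path (fun s => X s w) ->
  truncated_deviation delta w = ((truncated_limit delta w - t * a delta) ^+ 2)%:E.
Proof.
move=> d0 pw.
have c : ((truncated_sum X t delta n w - M delta n) ^+ 2)%:E @[n --> \oo] -->
    ((truncated_limit delta w - t * a delta) ^+ 2)%:E.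
  apply: cvg_EFin; first by near=> n.
  have c1 : truncated_sum X t delta n w - M delta n @[n --> \oo] -->
      truncated_limit delta w - t * a delta.
    apply: cvgB; first exact: (cvg_trunc_grid pw t0 d0).
    exact: (cvg_mean_trunc subX charX).
  by rewrite expr2; under eq_fun do rewrite /= expr2; exact: cvgM.
by rewrite /truncated_deviation is_cvg_limn_einfE ?(cvg_lim _ c)//; exact: (cvgP _ c).
Unshelve. all: by end_near. Qed.

Section subsequence.
Context (K : nat) (dl : nat -> R) (K0 : (0 < K)%N).
Hypothesis dl0 : forall k, 0 < dl k.
Hypothesis dlE : forall k, a (dl k) = (k + K)%:R * (k + K).+1%:R * dl k.

Let m k := t * a (dl k).

Let m0 k : 0 < m k.
Proof. by rewrite mulr_gt0// (drift_tail_gt0 levyPi drift0). Qed.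

(** A series of nonnegative functions with summable integrals is finite almost everywhere, so its
    terms, here the squared relative deviations, tend to 0. *)
Lemma ae_cvg_truncated_limit :
  {ae P, forall w, truncated_limit (dl k) w / a (dl k) @[k --> \oo] --> t}.
Proof.
pose Z k w := (((m k) ^- 2)%:E * truncated_deviation (dl k) w)%E.
have Z0 k w : (0 <= Z k w)%E.
  by rewrite mule_ge0 ?truncated_deviation_ge0// lee_fin invr_ge0 sqr_ge0.
have mZ k : measurable_fun setT (Z k).
  by apply: measurable_funeM; exact: measurable_truncated_deviation.
(* The bound is [dl k / m k], the inverse of t (k + K) (k + K + 1), written as a difference so that
   the sum over [k] telescopes. *)
have intZ k : (\int[P]_w Z k w <= (t^-1 * ((k + K)%:R^-1 - (k + K).+1%:R^-1))%:E)%E.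
  rewrite ge0_integralZl//; last 3 first.
  - exact: measurable_truncated_deviation.
  - by move=> w _; exact: truncated_deviation_ge0.
  - by rewrite lee_fin invr_ge0 sqr_ge0.
  apply: (@le_trans _ _ ((m k ^- 2)%:E * (dl k * m k)%:E)%E).
    rewrite lee_wpmul2l ?lee_fin ?invr_ge0 ?sqr_ge0//.
    exact: integral_truncated_deviation.
  rewrite -EFinM lee_fin le_eqVlt; apply/orP; left; apply/eqP.
  have kK : (0 : R) < (k + K)%:R by rewrite ltr0n addn_gt0 K0 orbT.
  rewrite /m dlE -natr1; move: (_%:R) kK => q q0; field.
  by rewrite !gt_eqF ?dl0//= ltr_wpDr.
have sumZ : (\int[P]_w (\sum_(k <oo) Z k w) < +oo)%E.
  rewrite integral_nneseries//.
  apply: (@le_lt_trans _ _ (t^-1 * K%:R^-1)%:E); last exact: ltry.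
  apply: lime_le; first by apply: is_cvg_nneseries => k _ _; exact: integral_ge0.
  near=> n.
  apply: (@le_trans _ _ (\sum_(0 <= k < n)
      (t^-1 * ((k + K)%:R^-1 - (k + K).+1%:R^-1))%:E)%E).
    by apply: lee_sum => k _; exact: intZ.
  rewrite sumEFin -mulr_sumr lee_fin ler_pM2l ?invr_gt0//.
  rewrite (telescope_sumr_eq (fun k => - (k + K)%:R^-1))//; last first.
    by move=> k _; rewrite opprK addrC addSn.
  by rewrite add0n opprK addrC lerBlDr lerDl invr_ge0.
have mS : measurable_fun setT (fun w => \sum_(k <oo) Z k w)%E.
  by apply: ge0_emeasurable_sum.
have iS : P.-integrable setT (fun w => \sum_(k <oo) Z k w)%E.
  apply/integrableP; split => //.
  under eq_integral do rewrite gee0_abs ?nneseries_ge0//.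
  exact: sumZ.
have := integrable_ae measurableT iS.
apply: filterS2 (subordinator_paths subX) => w pw /(_ I).
rewrite (@eq_eseriesr _ _
  (fun k => ((truncated_limit (dl k) w / m k - 1) ^+ 2)%:E)); last first.
  move=> k _; rewrite /Z truncated_deviationE// -EFinM; congr (_%:E).
  by rewrite -/(m k); field; rewrite gt_eqF.
move=> /cvg0_of_nneseries_fin-/(_ (fun k => sqr_ge0 _)) c0.
apply/cvgrPdist_lt => e e0.
have et : 0 < e / t by rewrite divr_gt0.
have /cvgrPdist_lt/(_ _ (exprn_gt0 2 et)) := c0.
apply: filterS => k; rewrite sub0r normrN ger0_norm ?sqr_ge0// => h.
have -> : t - truncated_limit (dl k) w / a (dl k) =
    - t * (truncated_limit (dl k) w / m k - 1).
  by rewrite /m; field; rewrite !gt_eqF// (drift_tail_gt0 levyPi drift0).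
rewrite normrM normrN (gtr0_norm t0) mulrC -ltr_pdivlMr//.
rewrite -(@ltr_pXn2r _ 2) ?nnegrE ?(ltW et)//.
by rewrite real_normK ?num_real.
Unshelve. all: by end_near. Qed.

End subsequence.

Section path_properties.
Context (w : T) (pw : subordinator_path (fun s => X s w)).

Lemma cvg_truncated_limit (delta : R) : 0 < delta ->
  truncated_sum X t delta n w @[n --> \oo] --> truncated_limit delta w.
Proof. exact: (cvg_trunc_grid pw t0). Qed.

Lemma truncated_limit_ge0 (delta : R) : 0 < delta -> 0 <= truncated_limit delta w.
Proof.
move=> d0; apply: (cvgr_to_ge (cvg_truncated_limit d0)).
by near=> n; apply: sumr_ge0 => i _; exact: trunc_ge0.
Unshelve. all: by end_near. Qed.

(** For each increment [b], [trunc delta b / delta] is nonincreasing in [delta]. Passing to the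
    limit in the sums treats the jumps and the continuous part together. *)
Lemma truncated_limit_anti (x y : R) : 0 < x -> x <= y ->
  truncated_limit y w / y <= truncated_limit x w / x.
Proof.
move=> x0 xy; have y0 := lt_le_trans x0 xy.
have cy : truncated_sum X t y n w / y @[n --> \oo] --> truncated_limit y w / y.
  by apply: cvgM; [exact: cvg_truncated_limit|exact: cvg_cst].
have cx : truncated_sum X t x n w / x @[n --> \oo] --> truncated_limit x w / x.
  by apply: cvgM; [exact: cvg_truncated_limit|exact: cvg_cst].
apply: (ler_cvg_to cy cx); near=> n.
rewrite /truncated_sum !mulr_suml; apply: ler_sum => i _.
rewrite ler_pdivrMr// mulrAC ler_pdivlMr// /trunc.
move: (increment _ _ _ _) => b; have [b0|b0] := leP b 0.
  by rewrite !max_r ?mul0r// ge_min b0.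
rewrite !max_l ?le_min ?(ltW b0) ?(ltW x0) ?(ltW y0)//.
by case: (leP b x) => ?; case: (leP b y) => ?; nra.
Unshelve. all: by end_near. Qed.

(** The limit of [truncated_limit (u k) w] is computed twice: as ratio times denominator it is
    [t * drift], and since the shortened jumps vanish it is the continuous part. *)
Lemma continuous_part_drift (u : nat -> R) :
  (forall k, 0 < u k) -> u k @[k --> \oo] --> 0 ->
  truncated_limit (u k) w / a (u k) @[k --> \oo] --> t ->
  continuous_part (fun s => X s w) t = drift * t.
Proof.
move=> u0 cu ct.
have ca : a (u k) @[k --> \oo] --> drift.
  by move/cvg_at_rightP : (@cvg_drift_tail0 _ _ drift levyPi); apply.
have cj : jump_sum (fun s => X s w) (u k) t @[k --> \oo] --> 0.
  by move/cvg_at_rightP : (cvg_jump_sum0 pw t0); apply.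
have c1 : truncated_limit (u k) w @[k --> \oo] --> t * drift.
  rewrite (_ : (fun k => _) =
      (fun k => truncated_limit (u k) w / a (u k) * a (u k))).
    exact: cvgM.
  by apply/funext => k; rewrite divfK// gt_eqF// (drift_tail_gt0 levyPi drift0).
have c2 : truncated_limit (u k) w @[k --> \oo] -->
    continuous_part (fun s => X s w) t + 0.
  by apply: cvgD; [exact: cvg_cst|].
rewrite mulrC -[LHS]addr0.
exact: (cvg_unique _ c2 c1).
Qed.

Lemma L_div_mu (delta : R) : 0 < delta ->
  continuous_part (fun s => X s w) t = drift * t ->
  (L drift (fun s => X s w) t delta / mu drift Pi delta =
   (truncated_limit delta w / a delta)%:E)%E.
Proof.
move=> d0 cE; rewrite /L /shortened esum_jump// (muE levyPi)//.
rewrite -EFinD -cE -EFinM inver gt_eqF; last first.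
  by rewrite divr_gt0// (drift_tail_gt0 levyPi drift0).
rewrite -EFinM; congr (_%:E); rewrite /truncated_limit /drift_tail; field.
by rewrite (gt_eqF (drift_tail_gt0 levyPi drift0 Pi_infinite d0)) gt_eqF.
Qed.

End path_properties.

End almost_sure_limit.

Theorem theorem2p8 (R : realType) (d : measure_display) (T : measurableType d)
    (P : probability T R) (X : R -> {RV P >-> R})
    (drift : R) (Pi : {measure set R -> \bar R})
    (subX : subordinator X) (charX : has_characteristics X drift Pi)
    (Pi_infinite : Pi `]0, +oo[%classic = +oo%E) :
  forall t : R, 0 < t ->
    {ae P, forall w,
      (L drift (fun s => X s w) t delta / mu drift Pi delta)%E
        @[delta --> 0^'+] --> t%:E}.
Proof.
move=> t t0; have [drift0 levyPi _] := charX.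
have [K [dl [K0 hdl]]] := drift_tail_scale levyPi drift0 Pi_infinite.
pose a := drift_tail Pi drift.
have dl0 k : 0 < dl k by have [/andP[]] := hdl k.
have dl1 k : dl k <= 1 by have [/andP[]] := hdl k.
have dlE k : a (dl k) = (k + K)%:R * (k + K).+1%:R * dl k by have [] := hdl k.
have a0 x : 0 < x -> 0 < a x by exact: drift_tail_gt0.
pose q k : R := (k + K)%:R * (k + K).+1%:R.
have cdl : dl k @[k --> \oo] --> 0.
  apply/cvgrPdist_lt => e e0; near=> k.
  rewrite sub0r normrN gtr0_norm//.
  (* As [dl k <= 1], monotonicity gives (k + K) (k + K + 1) dl k <= a 1, and the integer factor is
     at least k + 1. *)
  apply: (@le_lt_trans _ _ (a 1 / k.+1%:R)); last by near: k; exact: near_natSinv.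
  rewrite ler_pdivlMr// (le_trans _ (le_drift_tail drift levyPi (ltW (dl0 k)) (dl1 k)))//.
  rewrite [leRHS]dlE mulrC ler_pM2r// -natrM ler_nat.
  by rewrite (leq_trans _ (leq_pmull _ _))// ?ltnS ?leq_addr// addn_gt0 K0 orbT.
have := ae_cvg_truncated_limit subX charX Pi_infinite t0 K0 dl0 dlE.
apply: filterS2 (subordinator_paths subX) => w pw ct.
have cE := continuous_part_drift charX Pi_infinite t0 pw dl0 cdl ct.
have cSa : truncated_limit X t delta w / a delta @[delta --> 0^'+] --> t.
  apply: (cvg_ratio_of_subsequence (dl := dl) (q := q)) => //.
  - by move=> x x0; exact: truncated_limit_ge0.
  - by move=> x y x0 xy; exact: truncated_limit_anti.
  - by move=> x y; exact: drift_tail_anti.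
  - by move=> k; rewrite dlE mulfK// gt_eqF.
  - move=> k; rewrite /q -!natrM ltr_nat addSn ltn_mul//.
  - move=> x; near \oo => k; exists k.
    have xk : x <= k%:R by near: k; exact: nbhs_infty_ger.
    rewrite (le_trans xk)// /q -natrM ler_nat.
    by rewrite (leq_trans (leq_addr K k))// leq_pmulr.
  - apply/cvgrPdist_lt => e e0; near=> k.
    have -> : 1 - q k / q k.+1 = 2 / (k + K).+2%:R.
      rewrite /q addSn; set n := (k + K)%N.
      rewrite -[n.+2%:R]natr1 -[n.+1%:R]natr1.
      have : (0 : R) < n%:R by rewrite ltr0n addn_gt0 K0 orbT.
      move: (n%:R) => r r0; field.
      by rewrite !gt_eqF// ?ltr_wpDr// -addrA ltr_wpDr.
    rewrite ger0_norm ?divr_ge0//.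
    apply: (@le_lt_trans _ _ (2 / k.+1%:R)); last by near: k; exact: near_natSinv.
    by rewrite ler_pM2l// lef_pV2 ?posrE// ler_nat ltnS (leq_trans (leq_addr K k)).
apply: (@cvg_trans _ ((truncated_limit X t delta w / a delta)%:E @[delta --> 0^'+])).
  apply: near_eq_cvg; near=> x.
  have x0 : 0 < x by near: x; exact: nbhs_right_gt.
  by rewrite (L_div_mu charX).
by apply: cvg_EFin => //; near=> x.
Unshelve. all: by end_near. Qed.
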